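(* Let $(G,\mathcal{U},\varphi)$ be a self-similar ultragraph. Then the map $\pi:\mathcal{S}_{G,\mathcal{U}}\to\mathcal{O}_{G,\mathcal{U}}$ given by $\pi(0)=0$ and $\pi(\alpha,A,g,\beta)=s_\alpha u_{A,g}s_\beta^*$ is a universal tight representation, in the sense that $\pi$ is a tight representation and, if $\psi:\mathcal{S}_{G,\mathcal{U}}\to\mathcal{A}$ is a tight representation in a $C^*$-algebra $\mathcal{A}$, then there exists a unique $*$-homomorphism $\phi:\mathcal{O}_{G,\mathcal{U}}\to\mathcal{A}$ such that $\psi=\phi\circ\pi$. Consequently, $\mathcal{O}_{G,\mathcal{U}}\cong C^*_{\mathrm{tight}}(\mathcal{S}_{G,\mathcal{U}})$.
   Context: **Ultragraphs.** An ultragraph $\mathcal{U}=(U^0,\mathcal{U}^1,r,s)$ consists of a set $U^0$ of vertices, a set $\mathcal{U}^1$ of edges and maps $r,s:\mathcal{U}^1\to P(U^0)\setminus\{\emptyset\}$ ($P$ = power set) such that $r(e)$ is a singleton for every $e$. Standing assumption: $\mathcal{U}$ is row-finite without sources, i.e. $\{e\in\mathcal{U}^1: r(e)=\{v\}\}$ is nonempty and finite for all $v\in U^0$. $\mathcal{U}^0$ denotes the smallest subset of $P(U^0)$ containing $\emptyset$, all $\{v\}$ ($v\in U^0$), all $s(e)$ ($e\in\mathcal{U}^1$), and closed under finite $\cap,\cup,\setminus$. A path of length $n\ge1$ is a sequence $\alpha=e_1\cdots e_n$ of edges with $r(e_{i+1})\subseteq s(e_i)$; $r(\alpha)=r(e_1)$,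 $s(\alpha)=s(e_n)$, $|\alpha|=n$; $\mathcal{U}^{\ge1}$ is the set of all such paths. Concatenation $\alpha\beta$ is defined when $r(\beta)\subseteq s(\alpha)$. **Self-similar ultragraph.** A triple $(G,\mathcal{U},\varphi)$ where $\mathcal{U}=(U^0,\mathcal{U}^1,r,s)$ is a row-finite ultragraph without sources, $G$ is a countable discrete group with identity $1_G$ acting on $U^0\sqcup\mathcal{U}^1$ by ultragraph automorphisms (bijections preserving $U^0$ and $\mathcal{U}^1$ with $r(g\cdot e)=g\cdot r(e)$, $s(g\cdot e)=g\cdot s(e)$, where $g\cdot A=\{g\cdot v:v\in A\}$), and $\varphi:G\times\mathcal{U}^1\to G$ satisfies $\varphi(gh,e)=\varphi(g,h\cdot e)\varphi(h,e)$ and $\varphi(g,e)\cdot s(e)\subseteq g\cdot s(e)$. Extend to paths inductively by $g\cdot(\alpha_1\alpha_2)=(g\cdot\alpha_1)(\varphi(g,\alpha_1)\cdot\alpha_2)$, $\varphi(g,\alpha_1\alpha_2)=\varphi(\varphi(g,\alpha_1),\alpha_2)$. **The inverse semigroup $\mathcal{S}_{G,\mathcal{U}}$.** Add a universal path $\omega$ of length zero with $\omega\omega=\omega$, $\omega\alpha=\alpha\omega=\alpha$, $s(\omega)=r(\omega)=U^0$, $g\cdot\omega=\omega$, $\varphi(g,\omega)=g$; put $\mathcal{U}^\sharp=\{\omega\}\cup\mathcal{U}^{\ge1}$. Let $\mathcal{S}_{G,\mathcal{U}}=\{(\alpha,A,g,\beta):\alpha,\beta\in\mathcal{U}^\sharp,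 A\in\mathcal{U}^0, g\in G, \emptyset\ne A\subseteq s(\alpha)\cap g\cdot s(\beta)\}\cup\{0\}$, where $0$ is a zero element, with involution $(\alpha,A,g,\beta)^*=(\beta,g^{-1}\cdot A,g^{-1},\alpha)$, $0^*=0$, and product $(\alpha,A,g,\beta)(\gamma,B,h,\delta)$ equal to - $(\alpha(g\cdot\varepsilon),\ s(g\cdot\varepsilon)\cap(\varphi(g,\varepsilon)\cdot B),\ \varphi(g,\varepsilon)h,\ \delta)$ if $\gamma=\beta\varepsilon$, $\varepsilon\in\mathcal{U}^{\ge1}$, $g\cdot r(\varepsilon)\subseteq A$; - $(\alpha,\ A\cap(g\varphi(h^{-1},\varepsilon)^{-1}\cdot s(h^{-1}\cdot\varepsilon)),\ g\varphi(h^{-1},\varepsilon)^{-1},\ \delta(h^{-1}\cdot\varepsilon))$ if $\beta=\gamma\varepsilon$, $\varepsilon\in\mathcal{U}^{\ge1}$, $r(\varepsilon)\subseteq B$; - $(\alpha,A\cap(g\cdot B),gh,\delta)$ if $\gamma=\beta$ and $A\cap(g\cdot B)\neq\emptyset$; - $0$ otherwise. This is an inverse semigroup with zero. **The $C^*$-algebra $\mathcal{O}_{G,\mathcal{U}}$.** A Cuntz–Krieger $\mathcal{U}$-family consists of partial isometries $\{s_e:e\in\mathcal{U}^1\}$ with mutually orthogonal ranges and projections $\{p_A:A\in\mathcal{U}^0\}$ with (CK1) $p_\emptyset=0$, $p_Ap_B=p_{A\cap B}$, $p_{A\cup B}=p_A+p_B-p_{A\cap B}$; (CK2) $s_e^*s_e=p_{s(e)}$;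 (CK3) $s_es_e^*\le p_{r(e)}$; (CK4) $p_{\{v\}}=\sum_{r(e)=\{v\}}s_es_e^*$ for $v\in U^0$. A $(G,\mathcal{U})$-family is a collection $\{p_A,s_e\}\cup\{u_{A,g}:A\in\mathcal{U}^0,g\in G\}$ in a $C^*$-algebra such that (1) $\{p_A,s_e\}$ is a Cuntz–Krieger $\mathcal{U}$-family; (2) $u_{A,1_G}=p_A$; (3) $u_{A,g}^*=u_{g^{-1}\cdot A,g^{-1}}$; (4) $u_{A,g}u_{B,h}=u_{A\cap(g\cdot B),gh}$; (5) $u_{A,g}s_e=s_{g\cdot e}u_{g\cdot s(e),\varphi(g,e)}$ if $g\cdot r(e)\subseteq A$, and $u_{A,g}s_e=0$ otherwise. $\mathcal{O}_{G,\mathcal{U}}$ is the universal $C^*$-algebra generated by a $(G,\mathcal{U})$-family $\{p_A,s_e,u_{A,g}\}$. For $\alpha=e_1\cdots e_n\in\mathcal{U}^{\ge1}$, $s_\alpha=s_{e_1}\cdots s_{e_n}$, and $s_\omega$ is the identity of the multiplier algebra of $\mathcal{O}_{G,\mathcal{U}}$. **Tight representations.** For an inverse semigroup $\mathcal{S}$ with zero and idempotent semilattice $\mathcal{E}(\mathcal{S})$ (ordered by $e\le f\iff ef=e$), a representation in a $C^*$-algebra $\mathcal{A}$ is a map $\psi:\mathcal{S}\to\mathcal{A}$ with $\psi(0)=0$, $\psi(st)=\psi(s)\psi(t)$, $\psi(s^* )=\psi(s)^*$. For finite $X,Y\subseteq\mathcal{E}(\mathcal{S})$ let $\mathcal{E}(\mathcal{S})^{X,Y}=\{e: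 e\le f\ \forall f\in X,\ ef'=0\ \forall f'\in Y\}$; a cover of it is a subset $Z\subseteq\mathcal{E}(\mathcal{S})^{X,Y}$ such that every nonzero $e\in\mathcal{E}(\mathcal{S})^{X,Y}$ satisfies $ez\ne0$ for some $z\in Z$. $\psi$ is tight if for all finite $X,Y$ and every finite cover $Z$ of $\mathcal{E}(\mathcal{S})^{X,Y}$, $\bigvee_{e\in Z}\psi(e)=\bigwedge_{f\in X}\psi(f)\wedge\bigwedge_{f'\in Y}(1-\psi(f'))$ (lattice operations of commuting projections, $1$ the unit of the multiplier algebra of $\mathcal{A}$, empty meets equal $1$, empty joins equal $0$). $C^*_{\mathrm{tight}}(\mathcal{S})$ is the $C^*$-algebra generated by a universal tight representation of $\mathcal{S}$. *)

(* Defs.v *)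
From HB Require Import structures.
From mathcomp Require Import all_boot all_order all_algebra complex finmap.
From mathcomp Require Import all_classical all_reals all_analysis.
Set Implicit Arguments.
Unset Strict Implicit.
Unset Printing Implicit Defensive.
Import Order.TTheory GRing.Theory Num.Theory.
Import numFieldNormedType.Exports.
Local Open Scope classical_set_scope.
Local Open Scope ring_scope.

(* Complex C*-algebras, not necessarily unital, over [R[i]] where [R] is the
   field of real numbers.  MathComp rings are unital, hence a separate product
   [cmul].  The norm takes its values in [R[i]], as for every normed module
   over [R[i]]. *)
HB.mixin Record isCStarAlgebra (R : realType) V
    of CompleteNormedModule R[i] V := {
  cmul : V -> V -> V;
  cstar : V -> V;
  cmulA : associative cmul;
  cmulDl : left_distributive cmul +%R;
  cmulDr : right_distributive cmul +%R;
  cscaleAl : forall (a : R[i]) (x y : V), a *: cmul x y = cmul (a *: x) y;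
  cscaleAr : forall (a : R[i]) (x y : V), a *: cmul x y = cmul x (a *: y);
  cstarK : involutive cstar;
  cstarD : {morph cstar : x y / x + y};
  cstarZ : forall (a : R[i]) (x : V), cstar (a *: x) = a^* *: cstar x;
  cstarM : forall x y : V, cstar (cmul x y) = cmul (cstar y) (cstar x);
  norm_cmul : forall x y : V, `|cmul x y| <= `|x| * `|y|;
  norm_cstar : forall x : V, `|cmul (cstar x) x| = `|x| ^+ 2
}.

#[short(type="cstarAlgType")]
HB.structure Definition CStarAlgebra (R : realType) :=
  { V of isCStarAlgebra R V & CompleteNormedModule R[i] V }.

Declare Scope cstar_scope.
Delimit Scope cstar_scope with C.
Notation "x ** y" := (cmul x y) (at level 40, left associativity) : cstar_scope.
Notation "x ^#" := (cstar x) (at level 2, format "x ^#") : cstar_scope.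
Local Open Scope cstar_scope.

Section CStar.
Context {R : realType}.

Definition star_hom (A B : cstarAlgType R) (f : A -> B) : Prop :=
  [/\ linear f,
      (forall x y, f (x ** y) = f x ** f y)
    & (forall x, f (x^#) = (f x)^#)].

Definition star_iso (A B : cstarAlgType R) (f : A -> B) : Prop :=
  star_hom f /\ bijective f.

Definition isomorphic (A B : cstarAlgType R) : Prop :=
  exists f : A -> B, star_iso f.

Definition sub_cstar_algebra (A : cstarAlgType R) (B : set A) : Prop :=
  [/\ closed B, B 0,
      (forall (a : R[i]) x y, B x -> B y -> B (a *: x + y)),
      (forall x y, B x -> B y -> B (x ** y))
    & (forall x, B x -> B (x^#))].

Definition generated_by (A : cstarAlgType R) (X : set A) : Prop :=
  forall B : set A, sub_cstar_algebra B -> X `<=` B -> B = setT.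

Definition projection (A : cstarAlgType R) (p : A) : Prop :=
  p ** p = p /\ p^# = p.

Definition partial_isometry (A : cstarAlgType R) (s : A) : Prop :=
  s ** s^# ** s = s.

Definition proj_le (A : cstarAlgType R) (p q : A) : Prop := p ** q = p.

End CStar.

(* A multiplier [T] of [A] is the double centralizer [(L, R)] with [L a = T a]
   and [R a = a T].  In a C*-algebra such a pair automatically consists of
   bounded linear maps. *)
Record multiplier (R : realType) (A : cstarAlgType R) := Multiplier {
  mlact : A -> A;
  mract : A -> A;
  mactE : forall x y : A, x ** mlact y = mract x ** y
}.

Section Multiplier.
Context {R : realType} {A : cstarAlgType R}.
Implicit Types (S T : multiplier A) (a x y : A).

Lemma cmulBl x y z : (x - y) ** z = x ** z - y ** z :> A.
Proof.
by rewrite cmulDl -scaleN1r -cscaleAl scaleN1r.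
Qed.

Lemma cmulBr x y z : x ** (y - z) = x ** y - x ** z :> A.
Proof.
by rewrite cmulDr -scaleN1r -cscaleAr scaleN1r.
Qed.

Lemma multiplierP S T : mlact S =1 mlact T -> mract S =1 mract T -> S = T.
Proof.
case: S T => [l r lr] [l' r' lr'] /= /funext ll' /funext rr'.
by case: _ / ll' lr'; case: _ / rr' => lr'; congr Multiplier;
  exact: Prop_irrelevance.
Qed.

Fact mnull_subproof x y : x ** 0 = 0 ** y :> A.
Proof.
by rewrite -[in LHS](subrr x) cmulBr -[in RHS](subrr x) cmulBl !subrr.
Qed.
Definition mnull : multiplier A :=
  Multiplier (mlact := fun=> 0) (mract := fun=> 0) mnull_subproof.

Definition mone : multiplier A :=
  Multiplier (mlact := id) (mract := id) (fun _ _ => erefl).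

Fact madd_subproof S T x y :
  x ** (mlact S y + mlact T y) = (mract S x + mract T x) ** y.
Proof. by rewrite cmulDl cmulDr !mactE. Qed.
Definition madd S T : multiplier A := Multiplier (madd_subproof S T).

Fact msub_subproof S T x y :
  x ** (mlact S y - mlact T y) = (mract S x - mract T x) ** y.
Proof. by rewrite cmulBl cmulBr !mactE. Qed.
Definition msub S T : multiplier A := Multiplier (msub_subproof S T).

Fact mmul_subproof S T x y :
  x ** mlact S (mlact T y) = mract T (mract S x) ** y.
Proof. by rewrite !mactE. Qed.
Definition mmul S T : multiplier A := Multiplier (mmul_subproof S T).

Fact mstar_subproof S x y :
  x ** (mract S (y^#))^# = (mlact S (x^#))^# ** y.
Proof.
by apply: (can_inj cstarK); rewrite !cstarM !cstarK mactE.
Qed.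
Definition mstar S : multiplier A := Multiplier (mstar_subproof S).

Definition mincl a : multiplier A :=
  Multiplier (fun x y => cmulA x a y).

(* These are the lattice operations only on commuting projections. *)
Definition mmeet S T : multiplier A := mmul S T.
Definition mjoin S T : multiplier A := msub (madd S T) (mmul S T).

End Multiplier.
Arguments mnull {R} A.
Arguments mone {R} A.

(* Only the carrier and the operations of an inverse semigroup with zero
   enter the definitions of this section. *)
Record semigroup0 := Semigroup0 {
  sg_car :> choiceType;
  sg_mul : sg_car -> sg_car -> sg_car;
  sg_star : sg_car -> sg_car;
  sg_zero : sg_car
}.

Section Tight.
Context {R : realType} (S : semigroup0).
Local Notation "e * f" := (sg_mul e f).

Definition idempotents : set S := [set e | e * e = e].

Definition idem_between (X Y : {fset S}) : set S :=
  [set e | [/\ idempotents e,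
               (forall f, f \in X -> e * f = e)
             & (forall f, f \in Y -> e * f = sg_zero S)]].

Definition covers (Z X Y : {fset S}) : Prop :=
  [set` Z] `<=` idem_between X Y /\
  forall e, idem_between X Y e -> e <> sg_zero S ->
    exists2 z, z \in Z & e * z <> sg_zero S.

Definition representation (A : cstarAlgType R) (psi : S -> A) : Prop :=
  [/\ psi (sg_zero S) = 0,
      (forall s t, psi (s * t) = psi s ** psi t)
    & (forall s, psi (sg_star s) = (psi s)^#)].

Definition tight (A : cstarAlgType R) (psi : S -> A) : Prop :=
  representation psi /\
  forall X Y Z : {fset S},
    [set` X] `<=` idempotents -> [set` Y] `<=` idempotents -> covers Z X Y ->
    \big[mjoin/mnull A]_(e <- Z) mincl (psi e) =
    mmeet (\big[mmeet/mone A]_(f <- X) mincl (psi f))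
          (\big[mmeet/mone A]_(f <- Y) msub (mone A) (mincl (psi f))).

Definition universal_tight (O : cstarAlgType R) (pi : S -> O) : Prop :=
  tight pi /\
  forall (A : cstarAlgType R) (psi : S -> A), tight psi ->
    exists! phi : O -> A, star_hom phi /\ psi = phi \o pi.

Definition is_Cstar_tight (T : cstarAlgType R) (tau : S -> T) : Prop :=
  generated_by (range tau) /\ universal_tight tau.

End Tight.

Record ultragraph := Ultragraph {
  vert : Type;
  edge : choiceType;
  rng : edge -> set vert;
  src : edge -> set vert;
  rng_singleton : forall e, exists v, rng e = [set v];
  src_nonempty : forall e, src e !=set0;
  row_finite : forall v, finite_set [set e | rng e = [set v]];
  no_sources : forall v, [set e | rng e = [set v]] !=set0
}.

Inductive U0 (U : ultragraph) : set (vert U) -> Prop :=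
| U0_empty : U0 set0
| U0_vertex v : U0 [set v]
| U0_source e : U0 (src e)
| U0_setI A B : U0 A -> U0 B -> U0 (A `&` B)
| U0_setU A B : U0 A -> U0 B -> U0 (A `|` B)
| U0_setD A B : U0 A -> U0 B -> U0 (A `\` B).

(* The action of [G] on the disjoint union of vertices and edges, which
   preserves both parts, is given by its two restrictions. *)
Record self_similar (G : groupType) (U : ultragraph) := SelfSimilar {
  actV : G -> vert U -> vert U;
  actE : G -> edge U -> edge U;
  cocycle : G -> edge U -> G;
  actV1 : forall v, actV 1%g v = v;
  actVM : forall g h v, actV (g * h)%g v = actV g (actV h v);
  actE1 : forall e, actE 1%g e = e;
  actEM : forall g h e, actE (g * h)%g e = actE g (actE h e);
  rng_act : forall g e, rng (actE g e) = actV g @` rng e;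
  src_act : forall g e, src (actE g e) = actV g @` src e;
  cocycleM : forall g h e,
    cocycle (g * h)%g e = (cocycle g (actE h e) * cocycle h e)%g;
  cocycle_src : forall g e,
    actV (cocycle g e) @` src e `<=` actV g @` src e;
  group_countable : countable [set: G]
}.

(* Paths are sequences of edges, and the empty sequence is the universal
   path omega, with range and source the whole vertex set. *)
Section Paths.
Context {U : ultragraph}.
Implicit Types (a b : seq (edge U)) (e f : edge U).

Definition composable e f : bool := `[< rng f `<=` src e >].

Definition is_path a : bool := sorted composable a.

Definition prng a : set (vert U) := if a is e :: _ then rng e else setT.

Definition psrc a : set (vert U) :=
  if a is e :: a' then src (last e a') else setT.

Lemma psrc_rcons a e : psrc (rcons a e) = src e.
Proof. by case: a => //= f a; rewrite last_rcons. Qed.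

Lemma psrc_cat a b : b != [::] -> psrc (a ++ b) = psrc b.
Proof. by case/lastP: b => // b e _; rewrite -rcons_cat !psrc_rcons. Qed.

Lemma U0_psrc a : a != [::] -> U0 (psrc a).
Proof. by case: a => // e a _; exact: U0_source. Qed.

Lemma is_path_cat a b :
  is_path a -> is_path b -> prng b `<=` psrc a -> is_path (a ++ b).
Proof.
case: a => [|e a] // pa; case: b => [|f b] pb; first by rewrite cats0.
move=> fa; rewrite /is_path /= cat_path; apply/andP; split=> //=.
by apply/andP; split=> //; exact/asboolP.
Qed.

Lemma is_path_drop n a : is_path a -> is_path (drop n a).
Proof. exact: drop_sorted. Qed.

End Paths.

Section Action.
Context {G : groupType} {U : ultragraph} (X : self_similar G U).
Implicit Types (a b : seq (edge U)) (g h : G) (A B : set (vert U)).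

Definition actS g A : set (vert U) := actV X g @` A.

Fixpoint actP g a : seq (edge U) :=
  if a is e :: a' then actE X g e :: actP (cocycle X g e) a' else [::].

Definition pcocycle g a : G := foldl (cocycle X) g a.

Lemma actP_cat g a b : actP g (a ++ b) = actP g a ++ actP (pcocycle g a) b.
Proof. by elim: a g => //= e a IH g; rewrite IH. Qed.

Lemma pcocycle_cat g a b : pcocycle g (a ++ b) = pcocycle (pcocycle g a) b.
Proof. exact: foldl_cat. Qed.

Lemma actS1 A : actS 1%g A = A.
Proof.
rewrite /actS (_ : actV X 1%g = id) ?image_id//.
by apply/funext => v; rewrite actV1.
Qed.

Lemma actSM g h A : actS (g * h)%g A = actS g (actS h A).
Proof.
by rewrite /actS image_comp; congr image; apply/funext => v; rewrite actVM.
Qed.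

Lemma actSS g A B : A `<=` B -> actS g A `<=` actS g B.
Proof. exact: image_subset. Qed.

Lemma actSK g A : actS g^-1%g (actS g A) = A.
Proof. by rewrite -actSM mulVg actS1. Qed.

Lemma actSKV g A : actS g (actS g^-1%g A) = A.
Proof. by rewrite -actSM mulgV actS1. Qed.

Lemma actS_inj g u v : actV X g u = actV X g v -> u = v.
Proof. by move=> /(congr1 (actV X g^-1%g)); rewrite -!actVM mulVg !actV1. Qed.

Lemma actS_nonempty g A : A !=set0 -> actS g A !=set0.
Proof. by case=> v Av; exists (actV X g v), v. Qed.

Lemma actST g : actS g setT = setT.
Proof.
apply/seteqP; split=> // v _; exists (actV X g^-1%g v) => //.
by rewrite -actVM mulgV actV1.
Qed.

Lemma U0_actS g A : U0 A -> U0 (actS g A).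
Proof.
have inj : set_inj setT (actV X g) by move=> u v _ _; exact: actS_inj.
rewrite /actS; elim=> [|v|e|B C _ UB _ UC|B C _ UB _ UC|B C _ UB _ UC].
- by rewrite image_set0; exact: U0_empty.
- by rewrite image_set1; exact: U0_vertex.
- by rewrite -src_act; exact: U0_source.
- suff -> : actV X g @` (B `&` C) = (actV X g @` B) `&` (actV X g @` C)
    by exact: U0_setI.
  apply/seteqP; split=> [_ [u [Bu Cu] <-]|_ [[u Bu <-] [v Cv /actS_inj vu]]].
    by split; exists u.
  by exists u => //; split=> //; rewrite -vu.
- by rewrite image_setU; exact: U0_setU.
- suff -> : actV X g @` (B `\` C) = (actV X g @` B) `\` (actV X g @` C)
    by exact: U0_setD.
  apply/seteqP; split=> [_ [u [Bu Cu] <-]|_ [[u Bu <-] nC]].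
    by split; [exists u | move=> [v Cv /actS_inj vu]; apply: Cu; rewrite -vu].
  by exists u => //; split=> // Cu; apply: nC; exists u.
Qed.

Lemma actP_eq0 g a : (actP g a == [::]) = (a == [::]).
Proof. by case: a. Qed.

Lemma actP_rcons g a e :
  actP g (rcons a e) = rcons (actP g a) (actE X (pcocycle g a) e).
Proof. by rewrite -!cats1 actP_cat. Qed.

Lemma prng_actP g a : prng (actP g a) = actS g (prng a).
Proof. by case: a => [|e a] /=; [rewrite actST | rewrite rng_act]. Qed.

Lemma pcocycle_psrc g a :
  a != [::] -> actS (pcocycle g a) (psrc a) `<=` psrc (actP g a).
Proof.
case/lastP: a => // a e _; rewrite actP_rcons !psrc_rcons src_act.
by rewrite -cats1 pcocycle_cat; exact: cocycle_src.
Qed.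

Lemma actP_path g a : is_path a -> is_path (actP g a).
Proof.
elim/last_ind: a => //= a e IH pae.
have pa : is_path a.
  by move: pae; rewrite /is_path -cats1 => /cat_sorted2[].
rewrite actP_rcons -cats1; apply: is_path_cat => //; first exact: IH.
case: (eqVneq a [::]) => [->//|a0].
rewrite [prng _]/= rng_act => v ev; apply: (pcocycle_psrc a0).
apply: actSS ev.
case: a a0 pae {IH pa} => // f a _; rewrite /is_path /= rcons_path => /andP[_].
by move=> /asboolP.
Qed.

Record quad := Quad {
  qleft : seq (edge U);
  qset : set (vert U);
  qgrp : G;
  qright : seq (edge U)
}.

Definition valid (x : quad) : Prop :=
  [/\ is_path (qleft x), is_path (qright x), U0 (qset x), qset x !=set0
    & qset x `<=` psrc (qleft x) `&` actS (qgrp x) (psrc (qright x))].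

(* [None] is the zero element.  When [prefix b c] holds and [b != c], we have
   [c = b ++ drop (size b) c] with [drop (size b) c] nonempty. *)
Definition qmul (x y : quad) : option quad :=
  let: Quad a A g b := x in
  let: Quad c B h d := y in
  if b == c then
    if `[< A `&` actS g B !=set0 >]
    then Some (Quad a (A `&` actS g B) (g * h)%g d) else None
  else if prefix b c then
    let eps := drop (size b) c in
    if `[< actS g (prng eps) `<=` A >]
    then Some (Quad (a ++ actP g eps)
                    (psrc (actP g eps) `&` actS (pcocycle g eps) B)
                    (pcocycle g eps * h)%g d)
    else None
  else if prefix c b then
    let eps := drop (size c) b in
    if `[< prng eps `<=` B >]
    then let k := (g * (pcocycle h^-1 eps)^-1)%g in
         Some (Quad a (A `&` actS k (psrc (actP h^-1%g eps)))
                    k (d ++ actP h^-1%g eps))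
    else None
  else None.

Definition qstar (x : quad) : quad :=
  let: Quad a A g b := x in Quad b (actS g^-1%g A) g^-1%g a.

Definition ovalid (x : option quad) : Prop :=
  if x is Some q then valid q else True.

Lemma qmul_valid x y : valid x -> valid y -> ovalid (qmul x y).
Proof.
case: x y => [a A g b] [c B h d] [/= pa pb UA A0 sA] [/= pc pd UB B0 sB].
have sAa : A `<=` psrc a by move=> v /sA[].
have sAb : A `<=` actS g (psrc b) by move=> v /sA[].
have sBc : B `<=` psrc c by move=> v /sB[].
have sBd : B `<=` actS h (psrc d) by move=> v /sB[].
have dropP (u w : seq (edge U)) : u != w -> prefix u w ->
    drop (size u) w != [::] /\ psrc w = psrc (drop (size u) w).
  move=> uw /prefixP[w' wE]; subst w; rewrite drop_size_cat//.
  have w'0 : w' != [::] by apply: contraNneq uw => ->; rewrite cats0.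
  by rewrite psrc_cat.
case: eqP => [_|/eqP bc].
  case: asboolP => //= AB0; split=> //=.
  - by apply: U0_setI => //; exact: U0_actS.
  - move=> v [Av Bv]; split; first exact: sAa.
    by rewrite actSM; exact: (actSS sBd).
case: ifPn => [pbc|_].
  have [e0 ce] := dropP _ _ bc pbc.
  set eps := drop _ _ in e0 ce *; case: asboolP => //= eA.
  have pe : is_path eps by exact: is_path_drop.
  have sub : actS (pcocycle g eps) B `<=` psrc (actP g eps).
    by move=> v Bv; apply: (pcocycle_psrc e0); apply: actSS Bv; rewrite -ce.
  split=> //=.
  - apply: is_path_cat => //; first exact: actP_path.
    by rewrite prng_actP; exact: subset_trans eA sAa.
  - apply: U0_setI; last exact: U0_actS.
    by apply: U0_psrc; rewrite actP_eq0.
  - by rewrite setIC setIidl//; exact: actS_nonempty.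
  - rewrite psrc_cat ?actP_eq0//; apply: setIS.
    by rewrite actSM; exact: actSS.
case: ifPn => // pcb; rewrite eq_sym in bc.
have [e0 be] := dropP _ _ bc pcb.
set eps := drop _ _ in e0 be *; case: asboolP => //= eB.
have pe : is_path eps by exact: is_path_drop.
set k := (g * _)%g.
have sub : A `<=` actS k (psrc (actP h^-1%g eps)).
  apply: (subset_trans sAb); rewrite /k actSM be; apply: actSS.
  rewrite -[X in X `<=` _](actSK (pcocycle h^-1%g eps)); apply: actSS.
  exact: pcocycle_psrc.
split=> //=.
- apply: is_path_cat => //; first exact: actP_path.
  rewrite prng_actP -[psrc d](actSK h); apply: actSS.
  exact: subset_trans eB sBd.
- apply: U0_setI => //; apply: U0_actS; apply: U0_psrc.
  by rewrite actP_eq0.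
- by rewrite setIidl.
- by rewrite psrc_cat ?actP_eq0//; apply: setSI.
Qed.

Lemma qstar_valid x : valid x -> valid (qstar x).
Proof.
case: x => [a A g b] [/= pa pb UA A0 sA]; split=> //=.
- exact: U0_actS.
- exact: actS_nonempty.
- move=> v Av; split.
    rewrite -[psrc b](actSK g); apply: (actSS _ Av).
    by move=> w /sA[].
  by apply: (actSS _ Av) => w /sA[].
Qed.

Definition ssg := {x : option quad | ovalid x}.
HB.instance Definition _ := gen_eqMixin ssg.
HB.instance Definition _ := gen_choiceMixin ssg.

Definition oqmul (x y : option quad) : option quad :=
  if x is Some p then (if y is Some q then qmul p q else None) else None.

Fact oqmul_valid (x y : ssg) : ovalid (oqmul (sval x) (sval y)).
Proof. by case: x y => [[p|//] vp] [[q|//] vq]; exact: qmul_valid. Qed.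

Fact ostar_valid (x : ssg) : ovalid (omap qstar (sval x)).
Proof. by case: x => [[p|//] vp]; exact: qstar_valid. Qed.

Definition ssg_zero : ssg := exist _ None I.
Definition ssg_mul (x y : ssg) : ssg := exist _ _ (oqmul_valid x y).
Definition ssg_star (x : ssg) : ssg := exist _ _ (ostar_valid x).

Definition SGU : semigroup0 := Semigroup0 ssg_mul ssg_star ssg_zero.

Section Families.
Context {R : realType}.

(* A family is a triple of functions on all sets of vertices; only their
   values at members of [U0] are meaningful. *)
Definition CK_family (O : cstarAlgType R)
    (p : set (vert U) -> O) (s : edge U -> O) : Prop :=
  (forall e, partial_isometry (s e)) /\
  (forall e f, e <> f -> (s e)^# ** s f = 0) /\
  (forall A, U0 A -> projection (p A)) /\
  p set0 = 0 /\
  (forall A B, U0 A -> U0 B -> p A ** p B = p (A `&` B)) /\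
  (forall A B, U0 A -> U0 B -> p (A `|` B) = p A + p B - p (A `&` B)) /\
  (forall e, (s e)^# ** s e = p (src e)) /\
  (forall e, proj_le (s e ** (s e)^#) (p (rng e))) /\
  (forall v, p [set v] = \sum_(e \in [set e | rng e = [set v]]) s e ** (s e)^#).

Definition GU_family (O : cstarAlgType R) (p : set (vert U) -> O)
    (s : edge U -> O) (u : set (vert U) -> G -> O) : Prop :=
  CK_family p s /\
  (forall A, U0 A -> u A 1%g = p A) /\
  (forall A g, U0 A -> (u A g)^# = u (actS g^-1%g A) g^-1%g) /\
  (forall A B g h, U0 A -> U0 B ->
     u A g ** u B h = u (A `&` actS g B) (g * h)%g) /\
  (forall A g e, U0 A -> actS g (rng e) `<=` A ->
     u A g ** s e = s (actE X g e) ** u (actS g (src e)) (cocycle X g e)) /\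
  (forall A g e, U0 A -> ~ (actS g (rng e) `<=` A) -> u A g ** s e = 0).

Definition GU_generators (O : cstarAlgType R) (p : set (vert U) -> O)
    (s : edge U -> O) (u : set (vert U) -> G -> O) : set O :=
  (p @` @U0 U) `|` range s `|` [set x | exists A g, U0 A /\ x = u A g].

Definition is_OGU (O : cstarAlgType R) (p : set (vert U) -> O)
    (s : edge U -> O) (u : set (vert U) -> G -> O) : Prop :=
  [/\ GU_family p s u,
      generated_by (GU_generators p s u)
    & forall (A : cstarAlgType R) (p' : set (vert U) -> A) (s' : edge U -> A)
        (u' : set (vert U) -> G -> A), GU_family p' s' u' ->
      exists! phi : O -> A,
        [/\ star_hom phi,
            (forall B, U0 B -> phi (p B) = p' B),
            (forall e, phi (s e) = s' e)
          & (forall B g, U0 B -> phi (u B g) = u' B g)]].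

(* The empty product is [mone O], so [s_path s omega] is the identity of the
   multiplier algebra. *)
Definition s_path (O : cstarAlgType R) (s : edge U -> O) (a : seq (edge U)) :
    multiplier O :=
  \big[mmul/mone O]_(e <- a) mincl (s e).

Definition pi_map (O : cstarAlgType R) (s : edge U -> O)
    (u : set (vert U) -> G -> O) (x : SGU) : O :=
  if sval x is Some (Quad a A g b)
  then mract (mstar (s_path s b)) (mlact (s_path s a) (u A g))
  else 0.

End Families.
End Action.

(* Main.v *)
Require Import Defs.
From HB Require Import structures.
From mathcomp Require Import all_boot all_order all_algebra complex finmap.
From mathcomp Require Import all_classical all_reals all_analysis.
Set Implicit Arguments.
Unset Strict Implicit.
Unset Printing Implicit Defensive.
Import Order.TTheory GRing.Theory Num.Theory.
Import numFieldNormedType.Exports.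
Local Open Scope classical_set_scope.
Local Open Scope ring_scope.
Local Open Scope cstar_scope.

(** Computations take place in the multiplier algebra of a C*-algebra: it is a
    ring into which the algebra embeds, the universal path acts there as the
    identity, and the image of a quadruple becomes the honest product
    [S_a * u_(A,g) * S_b^*].  Pushing [u_(A,g)] through a path and
    cancelling [S_b^* S_b] turns the relations of a family into the four
    clauses of the product of the inverse semigroup ([quad_op_mul]), so [pi]
    is a representation.

    Tightness of [pi].  The nonzero idempotents are the quadruples
    [(a, A, 1, a)].  In terms of the product of the complements of a finite set
    [ws] of idempotents, tightness says: if every nonzero idempotent below a
    finite meet [x] meets some element of [ws], then [pi x * Q = 0], where [Q]
    is the product of the [1 - pi w] ([tight_criterion]).  A set of vertices
    may be infinite, so [x = (a, A, 1, a)] cannot be split into vertices at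
    once.  But the elements of [ws] with path [a], or with a shorter path,
    absorb a subset of [A] which belongs to the generalized Boolean algebra of
    sets, each [w] whose path properly extends [a] only touches one vertex of
    [A], and since [ws] is a cover nothing remains outside of these finitely
    many sets ([covered_step]).  Each of the finitely many vertices is split by
    the last Cuntz-Krieger relation into idempotents with a longer path, and the
    process stops at the longest path of [ws] ([covered_annihilates]).  If the
    meet is empty, it stands for the identity of the multiplier algebra; then
    [Q] annihilates all the [pi x], hence the closed *-subalgebra they generate,
    which is the whole algebra ([generators_annihilated]).

    Universality.  The images under a tight representation [psi] of the
    quadruples [(omega, A, g, omega)] and [(e, s(e), 1, omega)] form a family:
    only additivity on unions and the last Cuntz-Krieger relation need
    tightness, and both come from finite covers by pairwise orthogonal
    idempotents, over which the join is a sum ([orthogonal_cover_sum],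
    [tight_family]).  The universal property of the algebra yields a
    homomorphism, which composes with [pi] to [psi] as every quadruple is a
    product of the special ones and their adjoints ([rep_factors]).  Uniqueness
    holds because the generators of the algebra are values of [pi].  The
    isomorphism with the tight C*-algebra is the uniqueness of the solution of
    a universal problem. *)

(** * C*-algebras and their multipliers *)

Section CStarAlgebra.
Context {R : realType} {A : cstarAlgType R}.
Implicit Types x y z : A.

Lemma cmul0x x : 0 ** x = 0.
Proof. by rewrite -[in LHS](subrr x) cmulBl subrr. Qed.

Lemma cmulx0 x : x ** 0 = 0.
Proof. by rewrite -[in LHS](subrr x) cmulBr subrr. Qed.

Lemma cstar0 : (0 : A)^# = 0.
Proof. by apply: (addrI (0^#)); rewrite -cstarD !addr0. Qed.

(** The C*-identity makes the product nondegenerate. *)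
Lemma cstar_mul_eq0 x : x^# ** x = 0 -> x = 0.
Proof.
move=> /(congr1 (@Num.norm _ _)); rewrite norm_cstar normr0 => /eqP.
by rewrite sqrf_eq0 normr_eq0 => /eqP.
Qed.

Lemma cmul_extl x y : (forall z, z ** x = z ** y) -> x = y.
Proof.
move=> h; apply/subr0_eq/cstar_mul_eq0.
by rewrite cmulBr h subrr.
Qed.

Lemma cmul_extr x y : (forall z, x ** z = y ** z) -> x = y.
Proof.
move=> h; apply: (can_inj cstarK); apply: cmul_extl => z.
by apply: (can_inj cstarK); rewrite !cstarM !cstarK h.
Qed.

Lemma closed_kernel (f : A -> A) (k : R[i]) : 0 <= k ->
  {morph f : x y / x - y} -> (forall x, `|f x| <= `|x| * k) ->
  closed [set x | f x = 0].
Proof.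
move=> k0 fB fk; apply: (preimage_closed (f := f) (D := [set 0])).
  move=> x _; apply/(@cvgrPdist_lt _ _ _ (nbhs x)) => e e0.
  have k1 : 0 < k + 1 by rewrite ltr_wpDl.
  near=> y; rewrite /= -fB (le_lt_trans (fk _))//.
  apply: (@le_lt_trans _ _ (`|x - y| * (k + 1))).
    by rewrite ler_wpM2l// lerDl.
  rewrite -ltr_pdivlMr//; near: y.
  by apply: cvgr_dist_lt => //; rewrite divr_gt0.
exact/accessible_closed_set1/hausdorff_accessible/norm_hausdorff.
Unshelve. all: by end_near. Qed.

Lemma closed_lann z : closed [set x : A | x ** z = 0].
Proof.
apply: (closed_kernel (k := `|z|)) => // [x y|x]; first exact: cmulBl.
exact: norm_cmul.
Qed.

Lemma closed_rann z : closed [set x : A | z ** x = 0].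
Proof.
apply: (closed_kernel (k := `|z|)) => // [x y|x]; first exact: cmulBr.
by rewrite mulrC; exact: norm_cmul.
Qed.

End CStarAlgebra.

HB.instance Definition _ (R : realType) (A : cstarAlgType R) :=
  gen_eqMixin (multiplier A).
HB.instance Definition _ (R : realType) (A : cstarAlgType R) :=
  gen_choiceMixin (multiplier A).

(** A double centralizer is not assumed to be additive.  This follows, like the
    other identities between its two actions, from the fact that an element of
    a C*-algebra is determined by its products with all elements. *)
Section MultiplierRing.
Context {R : realType} {A : cstarAlgType R}.
Implicit Types (S T V : multiplier A) (x y z : A).

Lemma mlactD T x y : mlact T (x + y) = mlact T x + mlact T y.
Proof. by apply: cmul_extl => z; rewrite cmulDr !mactE cmulDr. Qed.

Lemma mractD T x y : mract T (x + y) = mract T x + mract T y.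
Proof. by apply: cmul_extr => z; rewrite cmulDl -!mactE cmulDl. Qed.

Lemma mlactM T x y : mlact T (x ** y) = mlact T x ** y.
Proof. by apply: cmul_extl => z; rewrite mactE !cmulA mactE. Qed.

Lemma mractM T x y : mract T (x ** y) = x ** mract T y.
Proof. by apply: cmul_extr => z; rewrite -mactE -!cmulA mactE. Qed.

Definition mopp S : multiplier A := msub (mnull A) S.

Fact maddA : associative (@madd R A).
Proof. by move=> S T V; apply: multiplierP => x /=; rewrite addrA. Qed.

Fact maddC : commutative (@madd R A).
Proof. by move=> S T; apply: multiplierP => x /=; rewrite addrC. Qed.

Fact madd0 : left_id (mnull A) madd.
Proof. by move=> S; apply: multiplierP => x /=; rewrite add0r. Qed.

Fact maddN : left_inverse (mnull A) mopp madd.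
Proof. by move=> S; apply: multiplierP => x /=; rewrite sub0r addNr. Qed.

HB.instance Definition _ :=
  GRing.isZmodule.Build (multiplier A) maddA maddC madd0 maddN.

Fact mmulA : associative (@mmul R A).
Proof. by move=> S T V; apply: multiplierP. Qed.

Fact mmul1l : left_id (mone A) mmul.
Proof. by move=> S; apply: multiplierP. Qed.

Fact mmul1r : right_id (mone A) mmul.
Proof. by move=> S; apply: multiplierP. Qed.

Fact mmulDl : left_distributive (@mmul R A) +%R.
Proof. by move=> S T V; apply: multiplierP => x //=; rewrite mractD. Qed.

Fact mmulDr : right_distributive (@mmul R A) +%R.
Proof. by move=> S T V; apply: multiplierP => x //=; rewrite mlactD. Qed.

HB.instance Definition _ := GRing.Zmodule_isPzRing.Build (multiplier A)
  mmulA mmul1l mmul1r mmulDl mmulDr.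

Lemma msubE S T : msub S T = S - T.
Proof. by apply: multiplierP => x /=; rewrite sub0r. Qed.

Lemma mjoinE S T : mjoin S T = S + T - S * T.
Proof. exact: msubE. Qed.

Lemma mincl0 : mincl 0 = 0 :> multiplier A.
Proof. by apply: multiplierP => x /=; rewrite ?cmul0x ?cmulx0. Qed.

Lemma minclD x y : mincl (x + y) = mincl x + mincl y :> multiplier A.
Proof. by apply: multiplierP => z /=; rewrite ?cmulDl ?cmulDr. Qed.

Lemma minclB x y : mincl (x - y) = mincl x - mincl y :> multiplier A.
Proof. by apply: (addIr (mincl y)); rewrite -minclD !subrK. Qed.

Lemma minclM x y : mincl (x ** y) = mincl x * mincl y :> multiplier A.
Proof. by apply: multiplierP => z /=; rewrite cmulA. Qed.

Lemma mincl_inj : injective (@mincl R A).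
Proof.
by move=> x y xy; apply: cmul_extr => z;
  exact: (congr1 (fun T : multiplier A => mlact T z) xy).
Qed.

Lemma mincl_sum I (r : seq I) (P : pred I) (F : I -> A) :
  mincl (\sum_(i <- r | P i) F i) =
  \sum_(i <- r | P i) mincl (F i) :> multiplier A.
Proof. exact: (big_morph _ minclD mincl0). Qed.

Lemma mincl_mulr x T : mincl x * T = mincl (mract T x).
Proof. by apply: multiplierP => z /=; rewrite ?mactE ?mractM. Qed.

Lemma mincl_star x : mstar (mincl x) = mincl (x^#).
Proof. by apply: multiplierP => z /=; rewrite cstarM cstarK. Qed.

Lemma mstar0 : mstar 0 = 0 :> multiplier A.
Proof. by rewrite -mincl0 mincl_star cstar0. Qed.

Lemma mstarM S T : mstar (S * T) = mstar T * mstar S.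
Proof. by apply: multiplierP => x /=; rewrite cstarK. Qed.

Lemma mstar1 : mstar 1 = 1 :> multiplier A.
Proof. by apply: multiplierP => x /=; rewrite cstarK. Qed.

Lemma mstarK T : mstar (mstar T) = T.
Proof. by apply: multiplierP => x /=; rewrite !cstarK. Qed.

(** The multipliers on both sides of an element can be pulled out of it, so that
    the values of [pi] become products in the multiplier ring. *)
Lemma mincl_sandwich S T x :
  mincl (mract (mstar T) (mlact S x)) = S * mincl x * mstar T.
Proof.
move: (mstar T) => V.
by apply: multiplierP => z /=; rewrite -mactE ?mlactM ?mractM.
Qed.

Lemma multiplier_eq0 T : (forall x, mincl x * T = 0) -> T = 0.
Proof.
move=> h; have h' x : mract T x = 0.
  by apply: mincl_inj; rewrite -mincl_mulr h mincl0.
apply: multiplierP => x; last by rewrite h'.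
by apply: cmul_extl => z; rewrite mactE h' cmul0x cmulx0.
Qed.

(** De Morgan: joins are handled through the products of the complements. *)
Lemma mjoin_compl I (r : seq I) (F : I -> multiplier A) :
  1 - \big[mjoin/mnull A]_(i <- r) F i = \prod_(i <- r) (1 - F i).
Proof.
elim: r => [|i r IH]; first by rewrite !big_nil subr0.
rewrite !big_cons -IH mjoinE mulrBl mul1r mulrBr mulr1.
by rewrite !opprD !opprK -!addrA; congr (_ + _); rewrite addrCA.
Qed.

End MultiplierRing.

#[local] Arguments qmul : simpl never.

(** * Self-similar actions on paths *)

Section SelfSimilarActions.
Context {G : groupType} {U : ultragraph} (X : self_similar G U).
Implicit Types (a b c d : seq (edge U)) (g h : G) (A B C D : set (vert U)).

Lemma actS0 g : actS X g set0 = set0.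
Proof. exact: image_set0. Qed.

Lemma actSI g A B : actS X g (A `&` B) = actS X g A `&` actS X g B.
Proof.
apply/seteqP; split=> [_ [v [Av Bv] <-]|_ [[v Av <-] [w Bw /actS_inj wv]]].
  by split; exists v.
by exists v => //; split=> //; rewrite -wv.
Qed.

Lemma cocycle1 e : cocycle X 1%g e = 1%g.
Proof.
have := cocycleM X 1%g 1%g e; rewrite mulg1 actE1 => h.
by apply: (@mulgI _ (cocycle X 1%g e)); rewrite -h mulg1.
Qed.

(** The inclusion required of the cocycle is an equality: the inverse of
    [cocycle g e] is the cocycle of [g^-1] at [actE g e], for which the
    inclusion holds as well. *)
Lemma cocycle_srcE g e :
  actS X (cocycle X g e) (src e) = src (actE X g e).
Proof.
apply/seteqP; split; first by rewrite src_act; exact: cocycle_src.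
have <- : (cocycle X g^-1 (actE X g e))^-1%g = cocycle X g e.
  by apply: mulg1_eq; rewrite -cocycleM mulVg cocycle1.
rewrite -[X in X `<=` _](actSKV X (cocycle X g^-1 (actE X g e))^-1%g) invgK.
apply: actSS; rewrite -[X in _ `<=` X](actSK X g (src e)).
by rewrite [actS X g (src e)]/actS -src_act; exact: cocycle_src.
Qed.

Lemma actP1 a : actP X 1%g a = a.
Proof. by elim: a => //= e a IH; rewrite actE1 cocycle1 IH. Qed.

Lemma pcocycle1 a : pcocycle X 1%g a = 1%g.
Proof. by elim: a => //= e a IH; rewrite cocycle1. Qed.

Lemma prng_singleton a : a != [::] -> exists v, prng a = [set v].
Proof. by case: a => // e a _; exact: rng_singleton. Qed.

Lemma U0_prng a : a != [::] -> U0 (prng a).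
Proof. by move=> /prng_singleton[v ->]; exact: U0_vertex. Qed.

Lemma prng_nonempty a : a != [::] -> prng a !=set0.
Proof. by move=> /prng_singleton[v ->]; exists v. Qed.

Lemma prng_cat a b : a != [::] -> prng (a ++ b) = prng a.
Proof. by case: a. Qed.

Lemma is_path_catP a b : is_path (a ++ b) ->
  [/\ is_path a, is_path b & b != [::] -> prng b `<=` psrc a].
Proof.
rewrite /is_path; case: a => [|e a] /=; first by split.
rewrite cat_path => /andP[pa pb]; split=> //.
  by move: pb; case: b => //= f b /andP[].
by move: pb; case: b => //= f b /andP[/asboolP].
Qed.

(** * Products in the inverse semigroup *)

Lemma qmul_eq a A g b B h d :
  qmul X (Quad a A g b) (Quad b B h d) =
  if `[< A `&` actS X g B !=set0 >]
  then Some (Quad a (A `&` actS X g B) (g * h)%g d) else None.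
Proof. by rewrite /qmul eqxx. Qed.

Lemma cat_neq_self a b : b != [::] -> (a == a ++ b) = false.
Proof.
move=> b0; apply: contraNF b0 => /eqP/(congr1 size)/eqP.
by rewrite size_cat -[X in X == _]addn0 eqn_add2l eq_sym size_eq0.
Qed.

Lemma qmul_ext a A g b c B h d : c != [::] ->
  qmul X (Quad a A g b) (Quad (b ++ c) B h d) =
  if `[< actS X g (prng c) `<=` A >]
  then Some (Quad (a ++ actP X g c)
               (psrc (actP X g c) `&` actS X (pcocycle X g c) B)
               (pcocycle X g c * h)%g d)
  else None.
Proof.
by move=> c0; rewrite /qmul cat_neq_self// prefix_prefix drop_size_cat.
Qed.

(** Taking adjoints exchanges the two cases of a product in which one of the
    inner paths properly extends the other. *)
Lemma qmul_coext a A g b c B h d : c != [::] ->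
  qmul X (Quad a A g (b ++ c)) (Quad b B h d) =
  omap (qstar X) (qmul X (qstar X (Quad b B h d))
                         (qstar X (Quad a A g (b ++ c)))).
Proof.
move=> c0.
rewrite [RHS](_ : _ = omap (qstar X) (qmul X
  (Quad d (actS X h^-1%g B) h^-1%g b)
  (Quad (b ++ c) (actS X g^-1%g A) g^-1%g a)))// qmul_ext//.
have nbc : prefix (b ++ c) b = false.
  apply: contraNF c0 => /size_prefix.
  by rewrite size_cat -[X in (_ <= X)%N]addn0 leq_add2l leqn0 size_eq0.
rewrite /qmul eq_sym cat_neq_self// nbc prefix_prefix drop_size_cat//.
have -> : `[< actS X h^-1%g (prng c) `<=` actS X h^-1%g B >]
        = `[< prng c `<=` B >].
  apply: asbool_equiv_eq; split => [|/actSS]; last exact.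
  by move=> /(@actSS _ _ X h); rewrite !actSKV.
case: asboolP => //= _; congr Some; congr Quad.
  by rewrite invgM invgK actSI -!actSM setIC mulgVK mulgV actS1.
by rewrite invgM invgK.
Qed.

Lemma qmul_orth a A g b c B h d : ~~ prefix b c -> ~~ prefix c b ->
  qmul X (Quad a A g b) (Quad c B h d) = None.
Proof.
move=> /[dup] nbc /negbTE bc /negbTE cb; rewrite /qmul bc cb.
by case: eqP nbc => // ->; rewrite prefix_refl.
Qed.

(** These alternatives match the four clauses of the product, with the
    extension [e] made explicit. *)
Variant path_compare b c : Prop :=
| PathEq of b = c
| PathExt e of e != [::] & c = b ++ e
| PathCoext e of e != [::] & b = c ++ e
| PathOrth of ~~ prefix b c & ~~ prefix c b.

Lemma path_compareP b c : path_compare b c.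
Proof.
case: (boolP (prefix b c)) => [/prefixP[e ->]|nbc].
  case: (eqVneq e [::]) => [->|e0]; last by apply: PathExt e0 _.
  by apply: PathEq; rewrite cats0.
case: (boolP (prefix c b)) => [/prefixP[e be]|ncb]; last exact: PathOrth.
apply: (PathCoext (e := e)) (be).
by apply: contraNneq nbc => e0; rewrite be e0 cats0 prefix_refl.
Qed.
End SelfSimilarActions.

(** * The semilattice of idempotents *)

Section Idempotents.
Context {G : groupType} {U : ultragraph} (X : self_similar G U).
Implicit Types (a b c d : seq (edge U)) (g h : G) (A B C D : set (vert U)).

Definition idq a A : @quad G U := Quad a A 1%g a.

Lemma valid_idq a A : valid X (idq a A) <->
  [/\ is_path a, U0 A, A !=set0 & A `<=` psrc a].
Proof.
rewrite /valid /= actS1 setIid.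
by split=> [[]|[]].
Qed.

Lemma qstar_idq a A : qstar X (idq a A) = idq a A.
Proof. by rewrite /qstar /= invg1 actS1. Qed.

Lemma qmul_idq_eq a A B : qmul X (idq a A) (idq a B) =
  if `[< A `&` B !=set0 >] then Some (idq a (A `&` B)) else None.
Proof. by rewrite qmul_eq actS1 mulg1. Qed.

Lemma qmul_idq_ext a c A B : c != [::] -> valid X (idq (a ++ c) B) ->
  qmul X (idq a A) (idq (a ++ c) B) =
  if `[< prng c `<=` A >] then Some (idq (a ++ c) B) else None.
Proof.
move=> c0 /valid_idq[_ _ _]; rewrite psrc_cat// => Bc.
by rewrite qmul_ext// actP1 pcocycle1 !actS1 mulg1 setIidr.
Qed.

Lemma qmul_idq_coext a c A B : c != [::] -> valid X (idq (a ++ c) A) ->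
  qmul X (idq (a ++ c) A) (idq a B) =
  if `[< prng c `<=` B >] then Some (idq (a ++ c) A) else None.
Proof.
move=> c0 vA; rewrite qmul_coext// -!/(idq _ _) !qstar_idq qmul_idq_ext//.
by case: asboolP => // _; exact: (congr1 Some (qstar_idq _ _)).
Qed.

(** In the clauses of unequal inner paths an outer path of the product is
    strictly longer, so an idempotent has [b = a], and then [g * g = g]. *)
Lemma qmul_idem x : qmul X x x = Some x -> exists a A, x = idq a A.
Proof.
case: x => a A g b.
have cat_neq (c d : seq (edge U)) : c != [::] -> d <> d ++ c.
  by move=> c0 /eqP; rewrite cat_neq_self.
case: (path_compareP b a) => [->|e e0 ->|e e0 ->|nba nab].
- rewrite qmul_eq; case: asboolP => // _ [_ /eqP].
  rewrite -[X in _ == X]mulg1 => gg; exists a, A; congr Quad.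
  by move/eqP: gg => /mulgI.
- rewrite qmul_ext//; case: asboolP => // _ [/esym/cat_neq].
  by rewrite actP_eq0.
- rewrite qmul_coext// [qmul _ _ _]qmul_ext//; case: asboolP => // _ [_ _].
  by move=> /esym/cat_neq; rewrite actP_eq0.
- by rewrite qmul_orth.
Qed.

(** The order of the idempotents [idq c C]: the idempotent of a proper
    extension [a e] lies below [idq a A] as soon as the range of [e] lies in
    [A], whatever its own set of vertices is. *)
Definition ile c C a A : Prop :=
  (c = a /\ C `<=` A) \/
  exists e, [/\ e != [::], c = a ++ e & prng e `<=` A].

Lemma ile_refl a A : ile a A a A.
Proof. by left; split. Qed.

(** A nonempty extension keeps the range of the path it extends. *)
Lemma ile_trans c C b B a A : ile c C b B -> ile b B a A -> ile c C a A.
Proof.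
move=> [[-> CB]|[e [e0 -> eB]]] [[-> BA]|[f [f0 -> fA]]].
- by left; split=> //; exact: subset_trans BA.
- by right; exists f.
- by right; exists e; split=> //; exact: subset_trans BA.
- right; exists (f ++ e); split; rewrite ?catA ?prng_cat//.
  by case: f f0 {fA}.
Qed.

Lemma qmul_ile c C a A : valid X (idq c C) -> ile c C a A ->
  qmul X (idq c C) (idq a A) = Some (idq c C).
Proof.
move=> vC [[ca CA]|[e [e0 ce eA]]]; last first.
  by rewrite ce qmul_idq_coext -?ce//; case: asboolP.
rewrite -ca qmul_idq_eq setIidl//; case: asboolP => // nC; case: nC.
by case/valid_idq: vC.
Qed.

Lemma qmul_idq a A b B : valid X (idq a A) -> valid X (idq b B) ->
  qmul X (idq a A) (idq b B) = None \/
  exists c C, [/\ qmul X (idq a A) (idq b B) = Some (idq c C),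
    ile c C a A & ile c C b B].
Proof.
move=> vA vB; case: (path_compareP a b) => [ab|e e0 be|e e0 ae|nab nba].
- rewrite -ab qmul_idq_eq; case: asboolP => _; [right|by left].
  by exists a, (A `&` B); split=> //; left; split=> //; exact: subIset; auto.
- rewrite be in vB *; rewrite qmul_idq_ext//.
  case: asboolP => eA; [right|by left].
  by exists (a ++ e), B; split=> //; [right; exists e | exact: ile_refl].
- rewrite ae in vA *; rewrite qmul_idq_coext//.
  case: asboolP => eB; [right|by left].
  by exists (b ++ e), A; split=> //; [exact: ile_refl | right; exists e].
- by left; exact: qmul_orth.
Qed.

(** * Elements of the inverse semigroup *)

Lemma SGU_inj (x y : SGU X) : sval x = sval y -> x = y.
Proof.
by case: x y => [x vx] [y vy] /= xy; case: _ / xy vy => vy; congr exist;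
  exact: Prop_irrelevance.
Qed.

(** Sending invalid quadruples, in particular those with an empty set of
    vertices, to zero lets the family attached to a representation be defined
    on all sets of vertices without case distinction. *)
Definition elt (x : @quad G U) : SGU X :=
  if pselect (valid X x) is left v then exist _ (Some x) v else ssg_zero X.

Lemma sval_elt x : valid X x -> sval (elt x) = Some x.
Proof. by rewrite /elt; case: pselect. Qed.

Lemma elt_invalid x : ~ valid X x -> elt x = sg_zero (SGU X).
Proof. by rewrite /elt; case: pselect. Qed.

Lemma SGU_cases (x : SGU X) :
  x = sg_zero (SGU X) \/ exists2 q, valid X q & x = elt q.
Proof.
case: x => [[q|] v]; [right|left; exact: SGU_inj].
by exists q => //; apply: SGU_inj; rewrite sval_elt.
Qed.

Lemma elt_mul x y : valid X x -> valid X y ->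
  sg_mul (elt x) (elt y) =
  if qmul X x y is Some z then elt z else sg_zero (SGU X).
Proof.
move=> vx vy; have vz := qmul_valid vx vy.
apply: SGU_inj; rewrite /= !sval_elt//=.
by case: (qmul X x y) vz => //= z vz; rewrite sval_elt.
Qed.

Lemma elt_star x : valid X x -> sg_star (elt x) = elt (qstar X x).
Proof.
move=> vx; apply: SGU_inj; rewrite /= !sval_elt//.
exact: qstar_valid.
Qed.

Lemma mul_eq0P x y : valid X x -> valid X y ->
  sg_mul (elt x) (elt y) = sg_zero (SGU X) <-> qmul X x y = None.
Proof.
move=> vx vy; have vz := qmul_valid vx vy.
rewrite elt_mul//; case: (qmul X x y) vz => //= z vz; split=> //.
by move=> /(congr1 sval); rewrite sval_elt.
Qed.

Lemma elt_neq0 x : valid X x -> elt x <> sg_zero (SGU X).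
Proof. by move=> vx /(congr1 sval); rewrite sval_elt. Qed.

Lemma mul0s (x : SGU X) : sg_mul (sg_zero (SGU X)) x = sg_zero (SGU X).
Proof. exact: SGU_inj. Qed.

Lemma muls0 (x : SGU X) : sg_mul x (sg_zero (SGU X)) = sg_zero (SGU X).
Proof. by apply: SGU_inj => /=; case: (sval x). Qed.

Lemma idempotentsP (x : SGU X) : idempotents x ->
  x = sg_zero (SGU X) \/ exists a A, valid X (idq a A) /\ x = elt (idq a A).
Proof.
case: (SGU_cases x) => [->|[q vq ->]]; first by left.
move=> q_idem; have : sg_mul (elt q) (elt q) = elt q := q_idem.
rewrite elt_mul//; have vz := qmul_valid vq vq.
case qq: (qmul X q q) vz => [z|] /= vz.
  move=> /(congr1 sval); rewrite !sval_elt// => -[zq].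
  right; rewrite zq in qq; have [a [A qE]] := qmul_idem qq.
  by exists a, A; rewrite -qE.
by move=> /esym/elt_neq0.
Qed.

Lemma idempotents0 : idempotents (sg_zero (SGU X)).
Proof. exact: mul0s. Qed.

Lemma idempotents_elt a A : valid X (idq a A) -> idempotents (elt (idq a A)).
Proof.
move=> vA; suff : sg_mul (elt (idq a A)) (elt (idq a A)) = elt (idq a A) by [].
by rewrite elt_mul// qmul_ile//; exact: ile_refl.
Qed.

Lemma mul_ile c C a A : valid X (idq c C) -> valid X (idq a A) ->
  sg_mul (elt (idq c C)) (elt (idq a A)) = elt (idq c C) -> ile c C a A.
Proof.
move=> vC vA; rewrite elt_mul//; have := qmul_valid vC vA.
case: (qmul_idq vC vA) => [-> _ /esym/elt_neq0|[d [D [-> _ dDaA]]] vD] //.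
by move=> /(congr1 sval); rewrite !sval_elt// => -[dc DC _]; rewrite -dc -DC.
Qed.

Lemma ile_meets c C a A : valid X (idq c C) -> valid X (idq a A) ->
  ile c C a A -> sg_mul (elt (idq c C)) (elt (idq a A)) <> sg_zero (SGU X).
Proof. by move=> vC vA cCaA; move/(mul_eq0P vC vA); rewrite qmul_ile. Qed.
End Idempotents.

(** * The representation carried by a family *)

Section Family.
Context {R : realType} {G : groupType} {U : ultragraph}.
Context (X : self_similar G U) {O : cstarAlgType R}.
Context (p : set (vert U) -> O) (s : edge U -> O).
Context (u : set (vert U) -> G -> O).
Hypothesis family : GU_family X p s u.
Implicit Types (a b c d : seq (edge U)) (g h : G) (A B C D : set (vert U)).

Local Notation P A := (mincl (p A)).
Local Notation Su e := (mincl (s e)).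
Local Notation Um A g := (mincl (u A g)).
Local Notation sp := (s_path s).

Lemma s_path_nil : sp [::] = 1.
Proof. exact: big_nil. Qed.

Lemma s_path_cons e a : sp (e :: a) = Su e * sp a.
Proof. exact: big_cons. Qed.

Lemma s_path_cat a b : sp (a ++ b) = sp a * sp b.
Proof.
elim: a => [|e a IH] /=; first by rewrite s_path_nil mul1r.
by rewrite !s_path_cons IH mulrA.
Qed.

Lemma family_p0 : p set0 = 0.
Proof. by have [[_ [_ [_ [? _]]]] _] := family. Qed.

Lemma family_pI A B : U0 A -> U0 B -> p A ** p B = p (A `&` B).
Proof. by have [[_ [_ [_ [_ [h _]]]]] _] := family; exact: h. Qed.

Lemma family_pU A B : U0 A -> U0 B -> p (A `|` B) = p A + p B - p (A `&` B).
Proof. by have [[_ [_ [_ [_ [_ [h _]]]]]] _] := family; exact: h. Qed.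

Lemma family_vertex v :
  p [set v] = \sum_(e \in [set e | rng e = [set v]]) s e ** (s e)^#.
Proof. by have [[_ [_ [_ [_ [_ [_ [_ [_ h]]]]]]]] _] := family. Qed.

Lemma family_u1 A : U0 A -> u A 1%g = p A.
Proof. by have [_ [h _]] := family; exact: h. Qed.

Lemma family_u_star A g : U0 A -> (u A g)^# = u (actS X g^-1%g A) g^-1%g.
Proof. by have [_ [_ [h _]]] := family; exact: h. Qed.

Lemma family_uM A B g h : U0 A -> U0 B ->
  u A g ** u B h = u (A `&` actS X g B) (g * h)%g.
Proof. by have [_ [_ [_ [hM _]]]] := family; exact: hM. Qed.

Lemma family_u0 g : u set0 g = 0.
Proof.
have U00 := @U0_empty U; have := family_uM 1%g g U00 U00.
by rewrite set0I mul1g family_u1// family_p0 cmul0x => <-.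
Qed.

Lemma edge_isometry e : mstar (Su e) * Su e = P (src e).
Proof.
rewrite mincl_star -minclM.
by have [[_ [_ [_ [_ [_ [_ [-> _]]]]]]] _] := family.
Qed.

Lemma edge_orthogonal e f : e <> f -> mstar (Su e) * Su f = 0.
Proof.
move=> ef; rewrite mincl_star -minclM.
by have [[_ [h _]] _] := family; rewrite h ?mincl0.
Qed.

Lemma edge_src e : Su e * P (src e) = Su e.
Proof.
rewrite -edge_isometry mincl_star -!minclM cmulA.
by have [[-> _] _] := family.
Qed.

Lemma edge_rng e : P (rng e) * Su e = Su e.
Proof.
have [[ps [_ [pP [_ [_ [_ [_ [le_rng _]]]]]]]] _] := family.
have U0r : U0 (rng e) := @U0_prng U [:: e] isT.
have /(congr1 (@cstar R O)) := le_rng e.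
rewrite !cstarM cstarK (pP _ U0r).2 => h.
by rewrite -[in RHS](ps e) -{}h -minclM -!cmulA [s e ** _]cmulA ps.
Qed.

Lemma edge_subset A e : U0 A -> rng e `<=` A -> P A * Su e = Su e.
Proof.
move=> UA eA; have U0r : U0 (rng e) := @U0_prng U [:: e] isT.
by rewrite -edge_rng mulrA -minclM family_pI// setIidr.
Qed.

Lemma edge_u A g e : U0 A -> actS X g (rng e) `<=` A ->
  Um A g * Su e = Su (actE X g e) * Um (src (actE X g e)) (cocycle X g e).
Proof.
move=> UA eA; rewrite -!minclM.
have [_ [_ [_ [_ [h _]]]]] := family.
by rewrite h// (_ : src (actE X g e) = actS X g (src e))//; exact: src_act.
Qed.

(** The inductive step needs that [cocycle g e] maps the source of [e] into the
    source of [actE g e], where the rest of the path starts. *)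
Lemma path_u A g a : U0 A -> is_path a -> a != [::] ->
  actS X g (prng a) `<=` A ->
  Um A g * sp a = sp (actP X g a) * Um (psrc (actP X g a)) (pcocycle X g a).
Proof.
elim: a A g => // e a IH A g UA pa _ eA.
have [_ p' ea] := @is_path_catP U [:: e] a pa.
rewrite s_path_cons mulrA edge_u// /= s_path_cons -!mulrA; congr (_ * _).
case: (eqVneq a [::]) => [->/=|a0]; first by rewrite s_path_nil mulr1 mul1r.
rewrite IH//.
- by congr (_ * mincl (u _ _)); case: (a) a0.
- exact: U0_source.
- by rewrite -cocycle_srcE; apply: actSS; exact: ea.
Qed.

Lemma path_u_eq0 A g a : U0 A -> a != [::] ->
  ~ (actS X g (prng a) `<=` A) -> Um A g * sp a = 0.
Proof.
case: a => // e a UA _ eA; rewrite s_path_cons mulrA -minclM.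
by have [_ [_ [_ [_ [_ h]]]]] := family; rewrite h ?mincl0 ?mul0r.
Qed.

Lemma path_subset A a : U0 A -> a != [::] -> prng a `<=` A ->
  P A * sp a = sp a.
Proof.
by case: a => // e a UA _ eA; rewrite s_path_cons mulrA edge_subset.
Qed.

Lemma path_isometry a : is_path a -> a != [::] ->
  mstar (sp a) * sp a = P (psrc a).
Proof.
elim: a => // e a IH pa _; have [_ p' ea] := @is_path_catP U [:: e] a pa.
rewrite s_path_cons mstarM -mulrA [mstar (Su e) * _]mulrA edge_isometry.
case: (eqVneq a [::]) => [->/=|a0].
  by rewrite s_path_nil mstar1 mulr1 mul1r.
rewrite path_subset//; [|exact: U0_source|exact: ea].
by rewrite IH//; case: (a) a0.
Qed.

(** This form also covers the universal path, whose [S_a^* S_a] is the identity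
    and not a projection [p B]. *)
Lemma path_isometry_u a A g : is_path a -> U0 A -> A `<=` psrc a ->
  mstar (sp a) * sp a * Um A g = Um A g.
Proof.
case: (eqVneq a [::]) => [->|a0] pa UA Aa.
  by rewrite s_path_nil mstar1 !mul1r.
rewrite path_isometry// -family_u1; last exact: U0_psrc.
by rewrite -minclM family_uM ?actS1 ?mul1g ?setIidr//; exact: U0_psrc.
Qed.

Lemma path_isometry_path a b : is_path (a ++ b) -> b != [::] ->
  mstar (sp a) * sp (a ++ b) = sp b.
Proof.
move=> /is_path_catP[pa pb ab] b0; rewrite s_path_cat mulrA.
case: (eqVneq a [::]) => [->|a0]; first by rewrite s_path_nil mstar1 !mul1r.
by rewrite path_isometry// path_subset//; [exact: U0_psrc | exact: ab].
Qed.

Lemma path_orthogonal a b : is_path b -> ~~ prefix a b -> ~~ prefix b a ->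
  mstar (sp a) * sp b = 0.
Proof.
elim: a b => [b _|e a IH [|f b]// pb]; first by rewrite prefix0s.
have [_ p' fb] := @is_path_catP U [:: f] b pb.
rewrite !s_path_cons mstarM -mulrA [mstar (Su e) * _]mulrA /=.
case: (eqVneq e f) => [->|/eqP ef] /=; last first.
  by move=> _ _; rewrite edge_orthogonal// mul0r mulr0.
move=> nab nba; have b0 : b != [::].
  by apply: contraNneq nba => ->; rewrite prefix0s.
rewrite edge_isometry path_subset//; [exact: IH|exact: U0_source|exact: fb].
Qed.

Definition quad_op (x : @quad G U) : multiplier O :=
  sp (qleft x) * Um (qset x) (qgrp x) * mstar (sp (qright x)).

Lemma quad_op_star x : U0 (qset x) ->
  quad_op (qstar X x) = mstar (quad_op x).
Proof.
case: x => a A g b /= UA.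
by rewrite /quad_op/= !mstarM mstarK mincl_star family_u_star// mulrA.
Qed.

Definition oquad_op (x : option (@quad G U)) : multiplier O :=
  if x is Some q then quad_op q else 0.

Lemma quad_op_mul_ext a A g b c B h d : c != [::] ->
  valid X (Quad a A g b) -> valid X (Quad (b ++ c) B h d) ->
  quad_op (Quad a A g b) * quad_op (Quad (b ++ c) B h d) =
  oquad_op (qmul X (Quad a A g b) (Quad (b ++ c) B h d)).
Proof.
move=> c0 [/= pa pb UA A0 sA] [/= pbc pd UB B0 sB].
have [_ pc _] := is_path_catP pbc.
rewrite qmul_ext// /quad_op/= -!mulrA.
rewrite [mstar (sp b) * _]mulrA path_isometry_path//.
rewrite [Um A g * (sp c * _)]mulrA; case: asboolP => [cA|ncA]; last first.
  by rewrite path_u_eq0// mul0r mulr0.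
rewrite path_u// /oquad_op /quad_op /= s_path_cat -!mulrA.
do 2 congr (_ * _); rewrite mulrA -minclM family_uM//.
by apply: U0_psrc; rewrite actP_eq0.
Qed.

(** The relations of a family, extended to paths, are the four clauses of the
    product; the third clause is the adjoint of the second. *)
Lemma quad_op_mul x y : valid X x -> valid X y ->
  quad_op x * quad_op y = oquad_op (qmul X x y).
Proof.
case: x y => [a A g b] [c B h d] vx vy.
case: (path_compareP b c) => [bc|e e0 ce|e e0 be|nbc ncb].
- case: bc vy => <- vy; case: vx vy => /= pa pb UA A0 sA [/= _ pd UB B0 sB].
  rewrite qmul_eq /quad_op/= -!mulrA [mstar (sp b) * _]mulrA.
  rewrite [mstar (sp b) * sp b * _]mulrA path_isometry_u//; last first.
    by move=> v /sB[].
  rewrite [Um A g * _]mulrA -minclM family_uM//.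
  case: asboolP => [_|]; first by rewrite /= /quad_op/= !mulrA.
  by move=> /set0P/negP/negPn/eqP ->; rewrite family_u0 mincl0 mul0r mulr0.
- by rewrite ce in vy *; exact: quad_op_mul_ext.
- rewrite be in vx *; rewrite qmul_coext//.
  have vx' := qstar_valid vx; have vy' := qstar_valid vy.
  set y := Quad c B h d; set x := Quad a A g (c ++ e).
  have : quad_op (qstar X y) * quad_op (qstar X x)
    = oquad_op (qmul X (qstar X y) (qstar X x)) by exact: quad_op_mul_ext.
  have UA : U0 A by case: vx.
  have UB : U0 B by case: vy.
  rewrite !quad_op_star// -mstarM => /(congr1 (@mstar R O)).
  rewrite mstarK => ->; have := qmul_valid vy' vx'.
  case: (qmul X _ _) => [z [_ _ Uz _ _]|_]; last exact: mstar0.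
  by rewrite /= quad_op_star.
- rewrite qmul_orth// /quad_op/= -!mulrA [mstar (sp b) * _]mulrA.
  by rewrite path_orthogonal ?mul0r ?mulr0//; case: vy.
Qed.

Local Notation pi := (pi_map (X := X) s u).

Lemma pi_mapE (x : SGU X) : mincl (pi x) = oquad_op (sval x).
Proof.
case: x => [[[a A g b]|] v] /=; last exact: mincl0.
by rewrite /pi_map/= mincl_sandwich.
Qed.

Lemma pi_map_elt x : valid X x -> mincl (pi (elt X x)) = quad_op x.
Proof. by move=> vx; rewrite pi_mapE sval_elt. Qed.

Lemma pi_map_representation : representation pi.
Proof.
split.
- by [].
- move=> x y; apply: mincl_inj; rewrite minclM !pi_mapE.
  case: x y => [[x|] vx] [[y|] vy]; rewrite /= ?mulr0 ?mul0r//.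
  by rewrite quad_op_mul.
- move=> x; apply: mincl_inj; rewrite -mincl_star !pi_mapE.
  case: x => [[x|] vx] /=; first by rewrite quad_op_star//; case: vx.
  by rewrite mstar0.
Qed.
End Family.

(** * Tightness of the representation *)

Lemma prod_compl_eq0 (M : pzRingType) (I : eqType) (r : seq I) (F : I -> M) i :
  {in r, forall j, F i * F j = F j * F i} -> F i * F i = F i -> i \in r ->
  F i * \prod_(j <- r) (1 - F j) = 0.
Proof.
move=> cF iF; elim: r => // j r IH in cF *.
rewrite inE big_cons mulrA => /orP[/eqP <-|ir].
  by rewrite mulrBr mulr1 iF subrr mul0r.
have -> : F i * (1 - F j) = (1 - F j) * F i.
  by rewrite mulrBr mulrBl mulr1 mul1r cF// mem_head.
by rewrite -mulrA IH ?mulr0// => k kr; rewrite cF// inE kr orbT.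
Qed.

Lemma prod_fix (M : pzRingType) (I : eqType) (r : seq I) (F : I -> M) x :
  (forall i, i \in r -> F i * x = x) -> (\prod_(i <- r) F i) * x = x.
Proof.
elim: r => [|i r IH] h; first by rewrite big_nil mul1r.
rewrite big_cons -mulrA IH; first by rewrite h// mem_head.
by move=> j jr; rewrite h// inE jr orbT.
Qed.

Section TightCriterion.
Context {R : realType} {G : groupType} {U : ultragraph}.
Context (X : self_similar G U) {A : cstarAlgType R} (psi : SGU X -> A).
Hypothesis rep : representation psi.
Local Notation S := (SGU X).
Local Notation mpsi := (fun e => mincl (psi e)).

Lemma idempotents_star (x : S) : idempotents x -> sg_star x = x.
Proof.
move=> /idempotentsP[->|[a [B [v ->]]]]; first exact: SGU_inj.
by rewrite elt_star// qstar_idq.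
Qed.

Lemma idempotents_mul (x y : S) : idempotents x -> idempotents y ->
  idempotents (sg_mul x y).
Proof.
move=> /idempotentsP[->|[a [B [vB ->]]]].
  by rewrite mul0s => _; exact: idempotents0.
move=> /idempotentsP[->|[b [C [vC ->]]]].
  by rewrite muls0; exact: idempotents0.
rewrite elt_mul//; have := qmul_valid vB vC.
case: (qmul_idq vB vC) => [-> _|[c [D [-> _ _]]] vD].
  exact: idempotents0.
exact: idempotents_elt.
Qed.

Lemma rep_idempotent (x : S) : idempotents x -> psi x ** psi x = psi x.
Proof. by have [_ <- _] := rep => ->. Qed.

(** The product of two idempotents is an idempotent, hence self-adjoint, and so
    is its image. *)
Lemma rep_commute (x y : S) : idempotents x -> idempotents y ->
  psi x ** psi y = psi y ** psi x.
Proof.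
have [_ psiM psiS] := rep => ix iy.
rewrite -psiM -[in LHS](idempotents_star (idempotents_mul ix iy)) psiS psiM.
by rewrite cstarM -!psiS !idempotents_star.
Qed.

(** Let [q] be the meet over [X] and the complements over [Y], and [J] the join
    over the cover [Z].  In every representation [q J = J], because [Z] lies
    below [X] and is orthogonal to [Y].  So tightness amounts to
    [q (1 - J) = 0], and [1 - J] is the product of the complements over [Z]: the
    hypothesis, applied with the union of [Y] and [Z] for [ws]. *)
Lemma tight_criterion :
  (forall xs ws : seq S, {in xs, forall x, idempotents x} ->
     {in ws, forall x, idempotents x} ->
     (forall e : S, idempotents e -> e <> sg_zero S ->
        {in xs, forall x, sg_mul e x = e} ->
        exists2 w, w \in ws & sg_mul e w <> sg_zero S) ->
     (\prod_(x <- xs) mpsi x) * (\prod_(w <- ws) (1 - mpsi w)) = 0) ->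
  tight psi.
Proof.
move=> vanish; split=> // XX Y Z iX iY [ZXY cover].
have [psi0 psiM psiS] := rep.
have iZ (z : S) : z \in Z -> idempotents z by move=> /ZXY[].
pose q := (\prod_(x <- XX) mpsi x) * (\prod_(y <- Y) (1 - mpsi y)).
set J := LHS; suff <- : q = J.
  congr (_ * _); apply: eq_bigr => y _; exact/esym/msubE.
have qz z : z \in Z -> q * mpsi z = mpsi z.
  move=> /[dup] /iZ iz /ZXY[_ zX zY].
  rewrite /q -mulrA [X in _ * X]prod_fix => [|y yY].
    apply: prod_fix => x xX.
    by rewrite -minclM (rep_commute (iX _ xX))// -psiM zX.
  rewrite mulrBl mul1r -minclM (rep_commute (iY _ yY))// -psiM zY//.
  by rewrite psi0 mincl0 subr0.
have qJ : q * J = J.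
  have : {subset (Z : seq S) <= Z} by [].
  rewrite /J; elim: (Z : seq S) => [|z r IH] rZ; first by rewrite big_nil mulr0.
  rewrite !big_cons mjoinE mulrBr mulrDr mulrA qz ?rZ ?mem_head// IH// => t tr.
  by rewrite rZ// inE tr orbT.
apply/eqP; rewrite -subr_eq0 -[X in _ - X]qJ -{1}[q]mulr1 -mulrBr mjoin_compl.
rewrite /q -mulrA -big_cat/=; apply/eqP/vanish => //.
  by move=> w; rewrite mem_cat => /orP[/iY|/iZ].
move=> e ie e0 eX.
have [[y yY ey]|nY] := pselect (exists2 y, y \in Y & sg_mul e y <> sg_zero S).
  by exists y; rewrite ?mem_cat ?yY.
have [|//|z zZ ez] := cover e; last by exists z; rewrite ?mem_cat ?zZ ?orbT.
split=> // y yY; apply: contrapT => ey; apply: nY; by exists y.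
Qed.
End TightCriterion.

Section FamilyTight.
Context {R : realType} {G : groupType} {U : ultragraph}.
Context (X : self_similar G U) {O : cstarAlgType R}.
Context (p : set (vert U) -> O) (s : edge U -> O).
Context (u : set (vert U) -> G -> O).
Hypothesis family : GU_family X p s u.
Implicit Types (a b c d : seq (edge U)) (g h : G) (A B C D : set (vert U)).
Local Notation P A := (mincl (p A)).
Local Notation Su e := (mincl (s e)).
Local Notation Um A g := (mincl (u A g)).
Local Notation sp := (s_path s).
Local Notation pi := (pi_map (X := X) s u).
Local Notation quad_op := (quad_op s u).
Local Notation T a A := (quad_op (idq a A)).

Lemma idq_op0 a : T a set0 = 0.
Proof. by rewrite /quad_op/= (family_u0 family) mincl0 mulr0 mul0r. Qed.

Lemma idq_opU a A B : U0 A -> U0 B ->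
  T a (A `|` B) = T a A + T a B - T a (A `&` B).
Proof.
move=> UA UB; have UI := U0_setI UA UB; have UU := U0_setU UA UB.
rewrite /quad_op/= !(family_u1 family)// (family_pU family)//.
by rewrite minclB minclD mulrBr mulrDr mulrBl mulrDl.
Qed.

Lemma idq_opI a A B : is_path a -> U0 A -> U0 B -> B `<=` psrc a ->
  T a A * T a B = T a (A `&` B).
Proof.
move=> pa UA UB Ba; rewrite /quad_op/= -!mulrA [mstar (sp a) * _]mulrA.
rewrite [mstar (sp a) * sp a * _]mulrA (path_isometry_u family)//.
by rewrite [Um A _ * _]mulrA -minclM (family_uM family)// actS1 mulg1 !mulrA.
Qed.

Lemma idq_op_edge a e :
  T (a ++ [:: e]) (src e) = sp a * (Su e * mstar (Su e)) * mstar (sp a).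
Proof.
rewrite /quad_op/= (family_u1 family); last exact: U0_source.
rewrite s_path_cat s_path_cons s_path_nil mulr1 -[sp a * _ * _]mulrA.
by rewrite (edge_src family) mstarM !mulrA.
Qed.

(** The relation at a vertex splits an idempotent into finitely many
    idempotents with longer paths. *)
Lemma idq_op_vertex (Q : multiplier O) a v :
  (forall e, rng e = [set v] -> T (a ++ [:: e]) (src e) * Q = 0) ->
  T a [set v] * Q = 0.
Proof.
move=> h; rewrite /quad_op/= (family_u1 family); last exact: U0_vertex.
rewrite (family_vertex family) fsbig_finite/=; last exact: row_finite.
rewrite mincl_sum mulr_sumr !mulr_suml big_seq big1// => e.
rewrite in_fset_set; last exact: row_finite.
by rewrite inE/= minclM -mincl_star -idq_op_edge => /h.
Qed.

Lemma idq_op_le c C a A : valid X (idq c C) -> valid X (idq a A) ->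
  ile c C a A -> T c C * T a A = T c C.
Proof.
by move=> vC vA cCA; rewrite (quad_op_mul family vC vA) qmul_ile.
Qed.

(** Let [ws] meet [idq a C] for every nonempty [C] in [A].  Each [w] of [ws] is
    absorbed by some [D] in [A]: the idempotent of [a] and [D] is annihilated,
    and what remains of [A] outside of [D] no longer meets [w].  Hence nothing
    remains of [A] outside of the union of these sets [D].  The hypothesis on
    ranges is the absorption of those [w] whose path properly extends [a]. *)
Lemma covered_step (Q : multiplier O) (ws : seq (SGU X)) a A :
  {in ws, forall w, idempotents w} ->
  {in ws, forall w, mincl (pi w) * Q = 0} ->
  valid X (idq a A) ->
  (forall e B, e != [::] -> valid X (idq (a ++ e) B) ->
    elt X (idq (a ++ e) B) \in ws -> prng e `<=` A -> T a (prng e) * Q = 0) ->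
  (forall C, valid X (idq a C) -> C `<=` A ->
    exists2 w, w \in ws & sg_mul (elt X (idq a C)) w <> sg_zero (SGU X)) ->
  T a A * Q = 0.
Proof.
move=> iws wsQ vA long cover; have [pa UA A0 Aa] := (valid_idq _ _ _).1 vA.
pose good D := [/\ U0 D, D `<=` A & T a D * Q = 0].
pose absorbs w D := forall C, valid X (idq a C) -> C `<=` A ->
  C `&` D = set0 -> sg_mul (elt X (idq a C)) w = sg_zero (SGU X).
have good0 : good set0.
  by split; [exact: U0_empty | by [] | rewrite idq_op0 mul0r].
have absorb w : w \in ws -> exists2 D, good D & absorbs w D.
  move=> wws; case/idempotentsP: (iws w wws) => [->|[b [B [vB wE]]]].
    by exists set0 => // C _ _ _; exact: muls0.
  have bQ : T b B * Q = 0 by rewrite -(pi_map_elt s u vB) -wE wsQ.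
  have [_ UB _ Bb] := (valid_idq _ _ _).1 vB.
  case: (path_compareP a b) => [ab|e e0 be|e e0 ae|nab nba].
  - exists (A `&` B) => [|C vC CA].
      split; [exact: U0_setI | exact: subIsetl |].
      by rewrite -idq_opI// ab// -mulrA bQ mulr0.
    rewrite wE setIA (setIidl CA) => CB0; apply/(mul_eq0P vC vB).
    by rewrite -ab qmul_idq_eq CB0; case: asboolP => // -[].
  - rewrite be in vB wE.
    have [eA|neA] := pselect (prng e `<=` A).
      exists (prng e) => [|C vC CA].
        split=> //; first exact: U0_prng.
        by apply: (long e B) => //; rewrite -wE.
      move=> Ce; rewrite wE; apply/(mul_eq0P vC vB).
      rewrite qmul_idq_ext//; case: asboolP => // eC.
      have [v ev] := prng_nonempty e0.
      suff : set0 v by []; by rewrite -Ce; split=> //; exact: eC.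
    exists set0 => // C vC CA _; rewrite wE; apply/(mul_eq0P vC vB).
    rewrite qmul_idq_ext//; case: asboolP => // eC.
    by case: neA; exact: subset_trans CA.
  - have [eB|neB] := pselect (prng e `<=` B).
      exists A => [|C vC CA].
        split=> //; rewrite -(idq_op_le vA vB) -1?mulrA ?bQ ?mulr0//.
        by right; exists e.
      rewrite (setIidl CA) => C0.
      by have [_ _ [v]] := (valid_idq _ _ _).1 vC; rewrite C0.
    exists set0 => // C vC CA _; rewrite wE; apply/(mul_eq0P vC vB).
    by rewrite ae qmul_idq_coext -?ae//; case: asboolP.
  - exists set0 => // C vC CA _; rewrite wE; apply/(mul_eq0P vC vB).
    exact: qmul_orth.
have [D gD Dws] : exists2 D, good D & {in ws, forall w, absorbs w D}.
  have : {subset ws <= ws} by [].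
  elim: {1 3}ws => [|w r IH] rws; first by exists set0.
  have [|D [UD DA DQ] Dr] := IH.
    by move=> t tr; rewrite rws// inE tr orbT.
  have [|E [UE EA EQ] Ew] := absorb w; first by rewrite rws// mem_head.
  exists (D `|` E) => [|t].
    split; [exact: U0_setU | by rewrite subUset |].
    rewrite idq_opU// -idq_opI//; last first.
      exact: subset_trans Aa.
    by rewrite mulrBl mulrDl DQ EQ -mulrA EQ mulr0 addr0 subr0.
  rewrite inE => /orP[/eqP ->|tr] C vC CA; rewrite setIUr setU_eq0 => -[CD CE].
    exact: Ew.
  exact: Dr.
have [UD DA DQ] := gD; suff <- : D = A by [].
apply/seteqP; split=> //; apply: contrapT => nAD.
have vC : valid X (idq a (A `\` D)).
  apply/valid_idq; split=> //; first exact: U0_setD.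
    apply: contrapT => /set0P/negP/negPn/eqP AD0; apply: nAD.
    by rewrite -setD_eq0.
  by move=> v [/Aa].
have [|w wws] := cover _ vC; first exact: subDsetl.
by case; apply: (Dws w wws) => //; exact: setDKI.
Qed.

(** The vertices at which a path of [ws] leaves [a] are split into idempotents
    with paths one edge longer; [n] bounds the excess of the paths of [ws] over
    [a]. *)
Lemma covered_annihilates (Q : multiplier O) (ws : seq (SGU X)) n a A :
  {in ws, forall w, idempotents w} ->
  {in ws, forall w, mincl (pi w) * Q = 0} ->
  valid X (idq a A) ->
  (forall b B, valid X (idq b B) -> elt X (idq b B) \in ws ->
    (size b <= size a + n)%N) ->
  (forall c C, valid X (idq c C) -> ile c C a A ->
    exists2 w, w \in ws & sg_mul (elt X (idq c C)) w <> sg_zero (SGU X)) ->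
  T a A * Q = 0.
Proof.
move=> iws wsQ; elim: n => [|n IH] in a A *.
all: move=> vA bound cover; apply: covered_step (iws) (wsQ) (vA) _ _.
all: try by move=> C vC CA; apply: cover => //; left.
  move=> e B e0 vB eBws _; have := bound _ _ vB eBws.
  by rewrite size_cat leq_add2l leqn0 size_eq0 (negbTE e0).
move=> e B e0 vB eBws eA; have [pa _ _ _] := (valid_idq _ _ _).1 vA.
have [paf _ _ _] := (valid_idq _ _ _).1 vB.
have [v ev] := prng_singleton e0; rewrite ev.
apply: idq_op_vertex => f fv.
have af : ile (a ++ [:: f]) (src f) a A.
  by right; exists [:: f]; split=> //=; rewrite fv -ev.
apply: IH => [|b C vC Cws|c C vC caf].
- apply/valid_idq; split; [|exact: U0_source|exact: src_nonempty|].
    apply: is_path_cat => //=; rewrite fv -ev.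
    by have [_ _] := is_path_catP paf; apply.
  by rewrite psrc_cat.
- by rewrite size_cat addn1 addSnnS; exact: bound Cws.
- by apply: cover => //; exact: ile_trans af.
Qed.

Definition below (a : seq (edge U)) A (x : SGU X) : Prop :=
  exists b B, [/\ valid X (idq b B), x = elt X (idq b B) & ile a A b B].

Lemma below_mul a A x : valid X (idq a A) -> below a A x ->
  sg_mul (elt X (idq a A)) x = elt X (idq a A).
Proof. by move=> vA [b [B [vB -> aAbB]]]; rewrite elt_mul// qmul_ile. Qed.

(** A nonempty meet is represented by zero or by a single idempotent, to which
    [covered_annihilates] applies. *)
Lemma idempotents_meet x (xs : seq (SGU X)) :
  {in x :: xs, forall x, idempotents x} ->
  \prod_(y <- x :: xs) mincl (pi y) = 0 \/
  exists a A, [/\ valid X (idq a A),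
    \prod_(y <- x :: xs) mincl (pi y) = T a A &
    {in x :: xs, forall y, below a A y}].
Proof.
elim: xs x => [|y xs IH] x ixs; rewrite big_cons.
  case/idempotentsP: (ixs x (mem_head _ _)) => [->|[a [A [vA ->]]]].
    by left; rewrite [pi _](_ : _ = 0)// mincl0 mul0r.
  right; exists a, A; rewrite big_nil mulr1 pi_map_elt//; split=> // y.
  by rewrite inE => /eqP ->; exists a, A; split=> //; exact: ile_refl.
have [|->|[b [B [vB -> Bys]]]] := IH y.
- by move=> z zys; apply: ixs; rewrite inE zys orbT.
- by left; rewrite mulr0.
case/idempotentsP: (ixs x (mem_head _ _)) => [->|[a [A [vA xE]]]].
  by left; rewrite [pi _](_ : _ = 0)// mincl0 mul0r.
rewrite xE pi_map_elt// (quad_op_mul family vA vB).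
have := qmul_valid vA vB.
case: (qmul_idq vA vB) => [-> _|[c [C [-> ca cb]]] /= vC]; [by left|right].
exists c, C; split=> // z; rewrite inE => /orP[/eqP ->|/Bys[d [D [vD -> bd]]]].
  by exists a, A.
by exists d, D; split=> //; exact: ile_trans bd.
Qed.

(** The elements [y] such that both [y] and its adjoint annihilate [Q] form a
    closed *-subalgebra.  It contains the generators, each of which has a
    factor [T a A] on its right. *)
Lemma generators_annihilated (Q : multiplier O) :
  generated_by (GU_generators p s u) ->
  (forall a A, valid X (idq a A) -> T a A * Q = 0) -> Q = 0.
Proof.
move=> gen TQ.
have PQ A : U0 A -> P A * Q = 0.
  move=> UA; have [->|/set0P A0] := eqVneq A set0.
    by rewrite (family_p0 family) mincl0 mul0r.
  have := TQ [::] A; rewrite /quad_op/= s_path_nil mstar1 mul1r mulr1.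
  by rewrite (family_u1 family)//; apply; apply/valid_idq; split.
have UQ A g : U0 A -> Um A g * Q = 0.
  move=> UA; have UA' : U0 (actS X g^-1%g A) by exact: U0_actS.
  have -> : Um A g = Um A g * P (actS X g^-1%g A).
    rewrite -minclM -(family_u1 family)// (family_uM family)//.
    by rewrite actSKV setIid mulg1.
  by rewrite -mulrA PQ// mulr0.
pose B := [set y : O | forall z, y ** mlact Q z = 0 /\ y^# ** mlact Q z = 0].
have BP y : mincl y * Q = 0 -> mstar (mincl y) * Q = 0 -> B y.
  move=> yQ ysQ z; rewrite mincl_star in ysQ.
  have h w : mincl w * Q = 0 -> w ** mlact Q z = 0.
    by move=> /(congr1 (fun S : multiplier O => mlact S z)).
  by split; exact: h.
have BT : B = setT.
  apply: gen; last first.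
    move=> _ [[[A UA <-]|[e _ <-]]|[A [g [UA ->]]]]; apply: BP.
    - exact: PQ.
    - rewrite mincl_star -(family_u1 family)// (family_u_star family)//.
      by apply: UQ; exact: U0_actS.
    - by rewrite -(edge_src family) -mulrA PQ ?mulr0//; exact: U0_source.
    - have -> : mstar (Su e) = mstar (Su e) * (Su e * mstar (Su e)).
        rewrite -[in LHS](edge_src family) -(edge_isometry family).
        by rewrite !mstarM mstarK mulrA.
      have := TQ ([::] ++ [:: e]) (src e); rewrite idq_op_edge//.
      rewrite s_path_nil mstar1 mul1r mulr1 -[in X in _ -> X]mulrA => ->.
        exact: mulr0.
      apply/valid_idq; split=> //; [exact: U0_source|exact: src_nonempty].
    - exact: UQ.
    - rewrite mincl_star (family_u_star family)//.
      by apply: UQ; exact: U0_actS.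
  split.
  - have -> : B = \bigcap_(z in setT) ([set y | y ** mlact Q z = 0] `&`
        [set y | (mlact Q z)^# ** y = 0]).
      apply/seteqP; split=> y yB z; last first.
        have [/= y1 y2] := yB z I; split=> //.
        by apply: (can_inj cstarK); rewrite cstarM cstarK y2 cstar0.
      move=> _; have [y1 y2] := yB z; split=> //=.
      by apply: (can_inj cstarK); rewrite cstarM cstarK y2 cstar0.
    by apply: closed_bigI => z _; apply: closedI;
      [exact: closed_lann|exact: closed_rann].
  - by move=> z; rewrite cstar0 cmul0x.
  - move=> k x y xB yB z; have [x1 x2] := xB z; have [y1 y2] := yB z.
    by rewrite cstarD cstarZ !cmulDl -!cscaleAl x1 x2 y1 y2 !scaler0 addr0.
  - move=> x y xB yB z; have [x1 x2] := xB z; have [y1 y2] := yB z.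
    by rewrite cstarM -!cmulA x2 y1 !cmulx0.
  - by move=> x xB z; have [x1 x2] := xB z; rewrite cstarK.
apply: multiplier_eq0 => x; rewrite mincl_mulr -[RHS]mincl0; congr mincl.
apply: cmul_extr => z; rewrite -mactE cmul0x.
by have : B x by [rewrite BT]; case/(_ z).
Qed.

Lemma pi_map_tight : generated_by (GU_generators p s u) -> tight pi.
Proof.
move=> gen; have rep := pi_map_representation family.
apply: tight_criterion => // xs ws ixs iws cover.
set Q := \prod_(w <- ws) _.
have wsQ : {in ws, forall w, mincl (pi w) * Q = 0}.
  move=> w wws; apply: (prod_compl_eq0 (F := fun w => mincl (pi w))) => //.
    by move=> v vws; rewrite -!minclM (rep_commute rep)//; exact: iws.
  by rewrite -minclM (rep_idempotent rep)//; exact: iws.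
pose len (w : SGU X) := if sval w is Some q then size (qleft q) else 0%N.
have annihilated a A : valid X (idq a A) ->
    (forall c C, valid X (idq c C) -> ile c C a A ->
       {in xs, forall x, sg_mul (elt X (idq c C)) x = elt X (idq c C)}) ->
    T a A * Q = 0.
  move=> vA axs.
  apply: (covered_annihilates (ws := ws) (n := \max_(w <- ws) len w)) => //.
    move=> b B vB bws; apply: leq_trans (leq_addl _ _).
    have -> : size b = len (elt X (idq b B)) by rewrite /len sval_elt.
    exact: leq_bigmax_seq.
  move=> c C vC cCaA; apply: cover; last exact: axs.
    exact: idempotents_elt.
  exact: elt_neq0.
case: xs => [|x xs] in ixs annihilated {cover} *.
  rewrite big_nil mul1r; apply: generators_annihilated => // a A vA.
  exact: annihilated.
case: (idempotents_meet ixs) => [->|[a [A [vA -> axs]]]]; first exact: mul0r.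
apply: annihilated => // c C vC cCaA y /axs[b [B [vB yE aAbB]]].
by apply: below_mul => //; exists b, B; split=> //; exact: ile_trans aAbB.
Qed.

End FamilyTight.

(** * The family carried by a tight representation *)

Section FamilyOfTight.
Context {R : realType} {G : groupType} {U : ultragraph}.
Context (X : self_similar G U) {A : cstarAlgType R} (psi : SGU X -> A).
Hypothesis psi_tight : tight psi.
Implicit Types (a b c d : seq (edge U)) (g h : G) (B C D : set (vert U)).

Definition rep_u B g : A := psi (elt X (Quad [::] B g [::])).
Definition rep_p B : A := rep_u B 1%g.
Definition edge_quad (e : edge U) : @quad G U := Quad [:: e] (src e) 1%g [::].
Definition rep_s (e : edge U) : A := psi (elt X (edge_quad e)).

Let rep : representation psi. Proof. by case: psi_tight. Qed.
Let psi0 : psi (sg_zero (SGU X)) = 0. Proof. by case: rep. Qed.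
Let psiM x y : psi (sg_mul x y) = psi x ** psi y. Proof. by case: rep. Qed.
Let psi_star x : psi (sg_star x) = (psi x)^#. Proof. by case: rep. Qed.

Lemma psi_mul x y : valid X x -> valid X y ->
  psi (elt X x) ** psi (elt X y) =
  if qmul X x y is Some z then psi (elt X z) else 0.
Proof.
by move=> vx vy; rewrite -psiM elt_mul//; case: (qmul X x y).
Qed.

Lemma valid_nil B g : U0 B -> B !=set0 -> valid X (Quad [::] B g [::]).
Proof. by move=> UB B0; split=> //= v _; split=> //; rewrite actST. Qed.

Lemma valid_edge e : valid X (edge_quad e).
Proof.
split=> //=; [exact: U0_source | exact: src_nonempty |].
by move=> v ev; split=> //; rewrite actST.
Qed.

Lemma rep_u0 g : rep_u set0 g = 0.
Proof. by rewrite /rep_u elt_invalid// => -[_ _ _ []]. Qed.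

Lemma rep_uM B C g h : U0 B -> U0 C ->
  rep_u B g ** rep_u C h = rep_u (B `&` actS X g C) (g * h)%g.
Proof.
move=> UB UC; have [->|/set0P B0] := eqVneq B set0.
  by rewrite set0I !rep_u0 cmul0x.
have [->|/set0P C0] := eqVneq C set0.
  by rewrite actS0 setI0 !rep_u0 cmulx0.
rewrite /rep_u psi_mul; [|exact: valid_nil..].
rewrite qmul_eq; case: asboolP => // /set0P/negP/negPn/eqP ->.
exact/esym/rep_u0.
Qed.

Lemma rep_u_star B g : U0 B -> (rep_u B g)^# = rep_u (actS X g^-1%g B) g^-1%g.
Proof.
move=> UB; have [->|/set0P B0] := eqVneq B set0.
  by rewrite actS0 !rep_u0 cstar0.
by rewrite /rep_u -psi_star elt_star//; exact: valid_nil.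
Qed.

Lemma rep_pI B C : U0 B -> U0 C -> rep_p B ** rep_p C = rep_p (B `&` C).
Proof. by move=> UB UC; rewrite rep_uM// actS1 mulg1. Qed.

Lemma rep_s_star e : (rep_s e)^# = psi (elt X (Quad [::] (src e) 1%g [:: e])).
Proof.
rewrite /rep_s -psi_star elt_star; last exact: valid_edge.
by rewrite /qstar/= invg1 actS1.
Qed.

Lemma valid_edge_star e : valid X (Quad [::] (src e) 1%g [:: e]).
Proof.
by have := qstar_valid (valid_edge e); rewrite /qstar/= invg1 actS1.
Qed.

Lemma valid_edge_idq e : valid X (idq [:: e] (src e)).
Proof.
by apply/valid_idq; split=> //; [exact: U0_source|exact: src_nonempty].
Qed.

Lemma rep_s_isometry e : (rep_s e)^# ** rep_s e = rep_p (src e).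
Proof.
rewrite rep_s_star psi_mul; [|exact: valid_edge_star|exact: valid_edge].
rewrite qmul_eq actS1 setIid mulg1; case: asboolP => // ns.
by case: ns; exact: src_nonempty.
Qed.

Lemma rep_s_range e : rep_s e ** (rep_s e)^# = psi (elt X (idq [:: e] (src e))).
Proof.
rewrite rep_s_star psi_mul; [|exact: valid_edge|exact: valid_edge_star].
rewrite qmul_eq actS1 setIid mulg1; case: asboolP => // ns.
by case: ns; exact: src_nonempty.
Qed.

Lemma rep_s_orthogonal e f : e <> f -> (rep_s e)^# ** rep_s f = 0.
Proof.
move=> /eqP ef; rewrite rep_s_star psi_mul;
  [|exact: valid_edge_star|exact: valid_edge].
by rewrite qmul_orth//= ?(negbTE ef)// eq_sym (negbTE ef).
Qed.

(** The correction terms in the join of commuting projections vanish when the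
    projections are pairwise orthogonal. *)
Lemma orthogonal_cover_sum (x : SGU X) (Z : {fset SGU X}) : idempotents x ->
  {in Z &, forall z t, z != t -> psi z ** psi t = 0} ->
  covers Z [fset x]%fset fset0 -> psi x = \sum_(z <- Z) psi z.
Proof.
move=> ix ortho cover; apply: mincl_inj; rewrite mincl_sum.
have : \big[mjoin/mnull A]_(e <- Z) mincl (psi e) =
    (\prod_(f <- [fset x]%fset) mincl (psi f)) *
    \prod_(f <- (fset0 : {fset SGU X})) msub 1 (mincl (psi f)).
  have [_ tg] := psi_tight.
  by apply: tg cover => y; rewrite /= inE// => /eqP ->.
rewrite big_seq_fset1 big_seq_fset0 mulr1 => <-.
have : {subset (Z : seq (SGU X)) <= Z} by [].
have : uniq (Z : seq (SGU X)) by exact: fset_uniq.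
elim: (Z : seq (SGU X)) => [|z r IH] /=; first by rewrite !big_nil.
move=> /andP[zr ur] rZ; rewrite !big_cons mjoinE IH//; last first.
  by move=> t tr; rewrite rZ// inE tr orbT.
rewrite mulr_sumr [X in _ - X]big_seq [X in _ - X]big1 ?subr0// => t tr.
rewrite -minclM.
rewrite ortho ?mincl0 ?rZ ?mem_head// ?inE ?tr ?orbT//.
by apply: contraNneq zr => ->.
Qed.

(** Below the union of [B] and [C], an idempotent with universal path has a
    vertex in [B] or in [C], and one with a proper path has its range, a single
    vertex, in one of them. *)
Lemma rep_p_disjoint B C : U0 B -> U0 C -> B `&` C = set0 ->
  rep_p (B `|` C) = rep_p B + rep_p C.
Proof.
move=> UB UC BC0; have [->|/set0P B0] := eqVneq B set0.
  by rewrite set0U [rep_p set0]rep_u0 add0r.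
have [->|/set0P C0] := eqVneq C set0.
  by rewrite setU0 [rep_p set0]rep_u0 addr0.
have vB : valid X (idq [::] B) by exact: valid_nil.
have vC : valid X (idq [::] C) by exact: valid_nil.
have vBC : valid X (idq [::] (B `|` C)).
  by apply: valid_nil; [exact: U0_setU | case: B0 => v; exists v; left].
have neBC : elt X (idq [::] B) != elt X (idq [::] C).
  apply/eqP => /(congr1 sval); rewrite !sval_elt// => -[BC].
  by case: B0 => v Bv; suff : set0 v by []; rewrite -BC0 -BC.
have psiBC : psi (elt X (idq [::] B)) ** psi (elt X (idq [::] C)) = 0.
  by rewrite [LHS](rep_pI UB UC) BC0; exact: rep_u0.
have psiCB : psi (elt X (idq [::] C)) ** psi (elt X (idq [::] B)) = 0.
  by rewrite [LHS](rep_pI UC UB) setIC BC0; exact: rep_u0.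
have := @orthogonal_cover_sum (elt X (idq [::] (B `|` C)))
  (elt X (idq [::] B) |` [fset elt X (idq [::] C)])%fset.
rewrite big_fsetU1 ?inE//= big_seq_fset1; apply.
- exact: idempotents_elt.
- move=> z t; rewrite !inE => /orP[]/eqP -> /orP[]/eqP -> //.
    by rewrite eqxx.
  by rewrite eqxx.
- split=> [z|e [ie ex _] e0].
    rewrite /= !inE => /orP[]/eqP ->; split=> //;
      rewrite ?in_fset0//; try exact: idempotents_elt.
    + move=> f; rewrite inE => /eqP ->.
      by apply: below_mul => //; exists [::], (B `|` C); split=> //; left.
    + move=> f; rewrite inE => /eqP ->.
      by apply: below_mul => //; exists [::], (B `|` C); split=> //; left.
  have {}ex := ex _ (fset11 _).
  case: (idempotentsP ie) e0 ex => [->//|[c [D [vD ->]]]] _.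
  move=> /(mul_ile vD vBC)[[c0 DBC]|[f [f0 cE fBC]]].
    have [_ _ [v Dv] _] := (valid_idq _ _ _).1 vD.
    rewrite c0 in vD *.
    have [Bv|Cv] := DBC _ Dv.
      exists (elt X (idq [::] B)); first by rewrite !inE eqxx.
      move/(mul_eq0P vD vB); rewrite qmul_idq_eq; case: asboolP => // -[].
      by exists v.
    exists (elt X (idq [::] C)); first by rewrite !inE eqxx orbT.
    move/(mul_eq0P vD vC); rewrite qmul_idq_eq; case: asboolP => // -[].
    by exists v.
  have [v fv] := prng_singleton f0.
  have [Bv|Cv] : (B `|` C) v by apply: fBC; rewrite fv.
    exists (elt X (idq [::] B)); first by rewrite !inE eqxx.
    apply: ile_meets => //; right; exists f; split=> //.
    by rewrite fv => _ ->.
  exists (elt X (idq [::] C)); first by rewrite !inE eqxx orbT.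
  apply: ile_meets => //; right; exists f; split=> //.
  by rewrite fv => _ ->.
Qed.

(** Both sides decompose over the disjoint pieces of [B] and [C]. *)
Lemma rep_pU B C : U0 B -> U0 C ->
  rep_p (B `|` C) = rep_p B + rep_p C - rep_p (B `&` C).
Proof.
move=> UB UC; have UD := U0_setD UC UB; have UI := U0_setI UB UC.
have -> : rep_p (B `|` C) = rep_p B + rep_p (C `\` B).
  rewrite -rep_p_disjoint//; last by rewrite setDE setICA setICr setI0.
  by rewrite setUDr setDv setD0.
have -> : rep_p C = rep_p (B `&` C) + rep_p (C `\` B).
  rewrite -rep_p_disjoint//; first by rewrite setIC setUIDK.
  by apply/seteqP; split=> // x [[Bx _] [_ /(_ Bx)]].
by rewrite [X in _ + X - _]addrC addrA addrK.
Qed.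

(** The idempotents of the edges with range [v] cover the vertex [v]: a path
    with range [v] starts with one of these edges, and for the universal path
    there is at least one such edge, as [v] is not a source. *)
Lemma rep_p_vertex v :
  rep_p [set v] =
  \sum_(e \in [set e | rng e = [set v]]) rep_s e ** (rep_s e)^#.
Proof.
have fin := @row_finite U v; rewrite fsbig_finite//=.
under eq_bigr do rewrite rep_s_range.
set E := fset_set _; pose I e := elt X (idq [:: e] (src e)).
have EP e : e \in E = (rng e = [set v]) :> Prop.
  by rewrite /E in_fset_set// propeqE; split; rewrite inE.
have I_inj : injective I.
  move=> e f /(congr1 sval); rewrite !sval_elt; try exact: valid_edge_idq.
  by case.
have vv : valid X (idq [::] [set v]).
  by apply: valid_nil; [exact: U0_vertex | exists v].
have <- : \sum_(z <- [fset I e | e in E]%fset) psi z = \sum_(e <- E) psi (I e).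
  by rewrite big_imfset//= => e f _ _; exact: I_inj.
apply: orthogonal_cover_sum.
- exact: idempotents_elt.
- move=> _ _ /imfsetP[e _ ->] /imfsetP[f _ ->] ef.
  rewrite -!rep_s_range -!cmulA [_ ** (rep_s f ** _)]cmulA.
  rewrite rep_s_orthogonal ?cmul0x ?cmulx0// => ef'.
  by rewrite ef' eqxx in ef.
- split=> [z /imfsetP[e eE ->]|x [ix xv _] x0].
    have ev : rng e = [set v] by rewrite -EP.
    split; rewrite ?in_fset0//.
      exact/idempotents_elt/valid_edge_idq.
    move=> f; rewrite inE => /eqP ->.
    apply: below_mul; first exact: valid_edge_idq.
    exists [::], [set v]; split=> //; right; exists [:: e]; split=> //=.
    by rewrite ev.
  have {}xv := xv _ (fset11 _).
  case: (idempotentsP ix) x0 xv => [->//|[c [D [vD ->]]]] _.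
  move=> /(mul_ile vD vv)[[c0 Dv]|[f [f0 cE fv]]].
    have [_ _ [w Dw] _] := (valid_idq _ _ _).1 vD.
    have wv : w = v by exact: Dv.
    have [e ev] := @no_sources U v.
    exists (I e); first by apply/imfsetP; exists e => //=; rewrite EP.
    rewrite c0 in vD *; move/(mul_eq0P vD (valid_edge_idq e)).
    rewrite (@qmul_idq_ext _ _ X [::] [:: e])//; last exact: valid_edge_idq.
    by case: asboolP => // -[]; rewrite /= ev => _ ->; rewrite -wv.
  rewrite /= in cE; case: f f0 cE fv => // e f _ cE /= ev; rewrite cE in vD *.
  have [pc _ _ Dc] := (valid_idq _ _ _).1 vD.
  exists (I e).
    apply/imfsetP; exists e => //=; rewrite EP.
    have [w ew] := @rng_singleton U e; rewrite ew in ev *.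
    by rewrite (ev w).
  apply: ile_meets => //; first exact: valid_edge_idq.
  have [f0|f0] := eqVneq f [::]; first by left; rewrite f0 in Dc *.
  right; exists f; split=> //.
  by have [_ _] := @is_path_catP U [:: e] f pc; apply.
Qed.

Lemma rep_us B g e : U0 B -> actS X g (rng e) `<=` B ->
  rep_u B g ** rep_s e =
  rep_s (actE X g e) ** rep_u (actS X g (src e)) (cocycle X g e).
Proof.
move=> UB eB; have B0 : B !=set0.
  by have [v ev] := rng_singleton e; exists (actV X g v); apply: eB;
    rewrite ev; exists v.
have USe : U0 (actS X g (src e)) by apply/U0_actS/U0_source.
have Se0 : actS X g (src e) !=set0 by apply/actS_nonempty/src_nonempty.
rewrite psi_mul; [|exact: valid_nil|exact: valid_edge].
rewrite (@qmul_ext _ _ X [::] B g [::] [:: e])//; case: asboolP => // _.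
rewrite psi_mul; [|exact: valid_edge|exact: valid_nil].
rewrite qmul_eq /= actS1 mulg1 mul1g cocycle_srcE.
rewrite (_ : actS X g (src e) = src (actE X g e)); last exact/esym/src_act.
by case: asboolP => // -[]; rewrite setIid; exact: src_nonempty.
Qed.

Lemma rep_us_eq0 B g e : U0 B -> ~ (actS X g (rng e) `<=` B) ->
  rep_u B g ** rep_s e = 0.
Proof.
move=> UB eB; have [->|/set0P B0] := eqVneq B set0.
  by rewrite rep_u0 cmul0x.
rewrite psi_mul; [|exact: valid_nil|exact: valid_edge].
by rewrite (@qmul_ext _ _ X [::] B g [::] [:: e])//; case: asboolP.
Qed.

Lemma tight_family : GU_family X rep_p rep_s rep_u.
Proof.
have rep_pP B : U0 B -> projection (rep_p B).
  move=> UB; split; first by rewrite rep_pI// setIid.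
  by rewrite [LHS]rep_u_star// invg1 actS1.
split; last first.
  split=> //; split; first by move=> B g; exact: rep_u_star.
  split; first by move=> B C g h; exact: rep_uM.
  by split=> B g e; [exact: rep_us | exact: rep_us_eq0].
split; first move=> e.
  rewrite /partial_isometry -cmulA rep_s_isometry /rep_s.
  rewrite psi_mul; [|exact: valid_edge|]; last first.
    by apply: valid_nil; [exact: U0_source|exact: src_nonempty].
  rewrite qmul_eq actS1 setIid mulg1; case: asboolP => // -[].
  exact: src_nonempty.
split; first by move=> e f; exact: rep_s_orthogonal.
split=> //; split; first exact: rep_u0.
split; first by move=> B C; exact: rep_pI.
split; first by move=> B C; exact: rep_pU.
split; first exact: rep_s_isometry.
split; last exact: rep_p_vertex.
move=> e; rewrite /proj_le rep_s_range /rep_p /rep_u.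
have vr : valid X (idq [::] (rng e)).
  apply: valid_nil; first exact: (@U0_prng _ [:: e]).
  exact: (@prng_nonempty _ [:: e]).
rewrite psi_mul//; last exact: valid_edge_idq.
rewrite qmul_ile//; first exact: valid_edge_idq.
by right; exists [:: e]; split.
Qed.
End FamilyOfTight.

(** * Universality *)

Lemma mract_star (R : realType) (A : cstarAlgType R) (T : multiplier A) x :
  mract (mstar T) x = (mlact T (x^#))^#.
Proof. by []. Qed.

Lemma star_hom0 (R : realType) (A B : cstarAlgType R) (f : A -> B) :
  star_hom f -> f 0 = 0.
Proof.
by case=> fl _ _; have := fl (-1) 0 0; rewrite scaler0 addr0 scaleN1r addNr.
Qed.

Lemma star_hom_id (R : realType) (A : cstarAlgType R) : star_hom (@id A).
Proof. by split. Qed.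

Lemma star_hom_comp (R : realType) (A B C : cstarAlgType R)
    (f : A -> B) (g : B -> C) : star_hom f -> star_hom g -> star_hom (g \o f).
Proof.
case=> fl fM fs [gl gM gs]; split => [k x y|x y|x] /=.
- by rewrite fl gl.
- by rewrite fM gM.
- by rewrite fs gs.
Qed.

Section Factorization.
Context {R : realType} {G : groupType} {U : ultragraph}.
Context (X : self_similar G U) {A : cstarAlgType R} (psi : SGU X -> A).
Hypothesis psi_tight : tight psi.
Implicit Types (a b : seq (edge U)) (g : G) (B : set (vert U)).

(** Every quadruple arises from one with universal left path by left products
    with edges; the adjoint handles the right path. *)
Lemma path_rep a B g b : valid X (Quad a B g b) ->
  mlact (s_path (rep_s psi) a) (psi (elt X (Quad [::] B g b))) =
  psi (elt X (Quad a B g b)).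
Proof.
elim: a => [|e a IH] v; first by rewrite s_path_nil.
have [/= pa pb UB B0 sB] := v.
have [_ pa' ea] := @is_path_catP U [:: e] a pa.
have Ba : B `<=` psrc a by case: (a) sB => // f a' sB w /sB[].
have va : valid X (Quad a B g b).
  by split=> //= w Bw; split; [exact: Ba | case: (sB _ Bw)].
rewrite s_path_cons /= IH// (psi_mul psi_tight) //; last exact: valid_edge.
have [a0|a0] := eqVneq a [::].
  rewrite a0 qmul_eq actS1 setIidr; last by move=> w /sB[]; rewrite a0.
  by rewrite mul1g; case: asboolP.
rewrite (@qmul_ext _ _ X [:: e] _ _ [::] a)// actP1 pcocycle1 !actS1 mul1g.
by rewrite setIidr//; case: asboolP => // -[]; exact: ea.
Qed.

Lemma rep_factors a B g b : valid X (Quad a B g b) ->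
  mract (mstar (s_path (rep_s psi) b))
    (mlact (s_path (rep_s psi) a) (rep_u psi B g)) =
  psi (elt X (Quad a B g b)).
Proof.
move=> v; have [pa pb UB B0 sB] := v.
have [[_ _ psi_star] _] := psi_tight.
have va : valid X (Quad a B g [::]).
  by split=> //= w Bw; split; [case: (sB _ Bw) | rewrite actST].
rewrite path_rep// mract_star -psi_star elt_star//.
have vs := qstar_valid v.
by rewrite path_rep// -psi_star elt_star//= invgK actSKV.
Qed.

Lemma pi_map_quad (O : cstarAlgType R) (s : edge U -> O)
    (u : set (vert U) -> G -> O) a B g b : valid X (Quad a B g b) ->
  pi_map s u (elt X (Quad a B g b)) =
  mract (mstar (s_path s b)) (mlact (s_path s a) (u B g)).
Proof. by move=> v; rewrite /pi_map sval_elt. Qed.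

Lemma hom_path (O : cstarAlgType R) (phi : O -> A) (s : edge U -> O) a x :
  star_hom phi ->
  phi (mlact (s_path s a) x) = mlact (s_path (phi \o s) a) (phi x).
Proof.
case=> _ phiM _; elim: a => [|e a IH]; first by rewrite !s_path_nil.
by rewrite !s_path_cons /= phiM IH.
Qed.

Lemma hom_pi (O : cstarAlgType R) (phi : O -> A) (s : edge U -> O)
    (u : set (vert U) -> G -> O) : star_hom phi ->
  phi \o s = rep_s psi ->
  (forall B g, U0 B -> phi (u B g) = rep_u psi B g) ->
  psi = phi \o pi_map (X := X) s u.
Proof.
move=> hphi phis phiu; have [_ _ phi_star] := hphi.
have [[psi0 _ _] _] := psi_tight.
apply/funext => x; have [->|[[a B g b] v ->]] := SGU_cases x.
  by rewrite /= psi0 /pi_map/= star_hom0.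
have UB : U0 B by case: v.
rewrite compE pi_map_quad// mract_star phi_star !(hom_path _ _ _ hphi) phi_star.
by rewrite (hom_path _ _ _ hphi) phis phiu// -rep_factors.
Qed.
End Factorization.

Section PiMapGenerators.
Context {R : realType} {G : groupType} {U : ultragraph}.
Context (X : self_similar G U) {O : cstarAlgType R}.
Context (p : set (vert U) -> O) (s : edge U -> O).
Context (u : set (vert U) -> G -> O).
Hypothesis family : GU_family X p s u.
Local Notation pi := (pi_map (X := X) s u).

Lemma pi_map_u B g : U0 B -> B !=set0 ->
  pi (elt X (Quad [::] B g [::])) = u B g.
Proof.
move=> UB B0; rewrite pi_map_quad; last exact: valid_nil.
by rewrite mract_star s_path_nil /= cstarK.
Qed.

Lemma pi_map_s e : pi (elt X (edge_quad e)) = s e.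
Proof.
rewrite pi_map_quad; last exact: valid_edge.
rewrite mract_star s_path_nil s_path_cons s_path_nil mulr1 /= cstarK.
apply: mincl_inj; rewrite minclM (family_u1 family) ?(edge_src family)//.
exact: U0_source.
Qed.
End PiMapGenerators.

(** The two induced homomorphisms are inverse to each other by uniqueness, since
    the identity also factors each map through itself. *)
Lemma universal_tight_unique (R : realType) (S : semigroup0)
    (A B : cstarAlgType R) (f : S -> A) (g : S -> B) :
  universal_tight f -> universal_tight g -> isomorphic A B.
Proof.
move=> [tf uf] [tg ug].
have [phi [[hphi gE] _]] := uf _ _ tg; have [chi [[hchi fE] _]] := ug _ _ tf.
have chiphi : chi \o phi = id.
  have [w [_ w_eq]] := uf _ _ tf; transitivity w; first apply/esym; apply: w_eq.
    by split; [exact: star_hom_comp | rewrite -compA -gE].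
  by split; first exact: star_hom_id.
have phichi : phi \o chi = id.
  have [w [_ w_eq]] := ug _ _ tg; transitivity w; first apply/esym; apply: w_eq.
    by split; [exact: star_hom_comp | rewrite -compA -fE].
  by split; first exact: star_hom_id.
exists phi; split=> //; exists chi => x.
  exact: (congr1 (fun h : A -> A => h x) chiphi).
exact: (congr1 (fun h : B -> B => h x) phichi).
Qed.

Theorem theorem8p4 (R : realType) (G : groupType) (U : ultragraph)
    (X : self_similar G U) (O : cstarAlgType R)
    (p : set (vert U) -> O) (s : edge U -> O) (u : set (vert U) -> G -> O)
    (hO : is_OGU X p s u) :
  universal_tight (pi_map (X := X) s u) /\
  (forall (T : cstarAlgType R) (tau : SGU X -> T),
     is_Cstar_tight tau -> isomorphic O T).
Proof.
have [family gen univ] := hO.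
suff up : universal_tight (pi_map (X := X) s u).
  by split=> // T tau [_ utau]; exact: universal_tight_unique up utau.
split; first exact: pi_map_tight gen.
move=> A psi psi_tight.
have [phi [[hphi phip phis phiu] phi_eq]] :=
  univ _ _ _ _ (tight_family psi_tight).
exists phi; split.
  split=> //; apply: hom_pi => //; exact/funext.
move=> chi [hchi psiE]; apply: phi_eq.
have chi_u B g : U0 B -> chi (u B g) = rep_u psi B g.
  move=> UB; have [->|/set0P B0] := eqVneq B set0.
    by rewrite (family_u0 family) (rep_u0 psi_tight); exact: star_hom0.
  by rewrite /rep_u psiE compE pi_map_u.
split=> // [B UB|e]; first by rewrite -(family_u1 family)// chi_u.
by rewrite /rep_s psiE compE (pi_map_s family).
Qed.
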